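(* A price vector $\boldsymbol\rho\in\mathbb R^{\mathcal S}$ solves the bi-level problem $$\min_{\boldsymbol{\rho}\in\mathbb{R}^{\mathcal S}}\ \sum_{s\in\mathcal S} m_s\quad\text{subject to}\quad m_s=\Big|\sum_{r\in\mathcal R}q_{rs}-(D_s-b_s\rho_s)\Big|\ \ \forall s\in\mathcal S,\quad \mathbf q \text{ part of an optimal solution of the lower-level problem } \mathrm{(LL}(\boldsymbol\rho)\mathrm{)},$$ if and only if $\boldsymbol\rho$ solves the single-level problem $\mathrm{(SL)}$, i.e. $\boldsymbol\rho$ is a vector of optimal dual variables of the constraints $\sum_{r\in\mathcal R}q_{rs}=d_s$ ($s\in\mathcal S$) of $\mathrm{(SL)}$.
   Context: Setting. $\mathcal G=(\mathcal N,\mathcal A)$ is a finite directed graph (transportation network) with node-link incidence matrix $A$ (in each link's column, entry $1$ at its starting node, $-1$ at its ending node, $0$ elsewhere). $\mathcal R\subset\mathcal N$ is the set of driver nodes, $\mathcal S\subset\mathcal N$ the set of rider nodes, $\mathcal K\subset\mathcal N$ the set of final destinations of vehicles departing from rider nodes. The network is interconnected: every $s\in\mathcal S$ can be reached from every $r\in\mathcal R$ and every $k\in\mathcal K$ from every $s\in\mathcal S$ by directed paths. For nodes $i,j$, $E_{ij}\in\mathbb R^{\mathcal N}$ is the O-D incidence vector with $1$ at $i$, $-1$ at $j$ and $0$ elsewhere, with $E_{ij}=\mathbf 0$ if $i=j$. For each link $a$, $t_a:[0,\infty)\to[0,\infty)$ is its travel time function, continuous and strictly increasing. Data: $Q_r>0$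 is the number of drivers initially at $r\in\mathcal R$; $\bar D_s\ge0$ is the total number of vehicles departing from $s$; $\delta_{sk}\ge 0$ is the fraction of the travel originating from $s$ that goes to $k$; $\beta_{0,s}\in\mathbb R$, $\beta_1>0$, $\beta_2>0$ are utility parameters; $D_s$ and $b_s>0$ are the coefficients of the linear ride demand function $D_s-b_s\rho_s$ at location $s$, where $\rho_s$ is the price at $s$. Flow constraints (F), for nonnegative link-flow vectors $\hat{\mathbf v}_{rs}\in\mathbb R_+^{\mathcal A}$ ($r\in\mathcal R,s\in\mathcal S$), $\check{\mathbf v}_{sk}\in\mathbb R_+^{\mathcal A}$ ($s\in\mathcal S,k\in\mathcal K$) and relocation flows $q_{rs}\ge 0$: $\mathbf v=\sum_{r,s}\hat{\mathbf v}_{rs}+\sum_{s,k}\check{\mathbf v}_{sk}$; $A\hat{\mathbf v}_{rs}=q_{rs}E_{rs}$ for all $r,s$; $A\check{\mathbf v}_{sk}=\bar d_{sk}E_{sk}$ for all $s,k$; $\sum_{s\in\mathcal S}q_{rs}=Q_r$ for all $r$; $\bar d_{sk}=\delta_{sk}\bar D_s$ for all $s,k$. Lower-level problem $\mathrm{(LL}(\boldsymbol\rho)\mathrm{)}$, given prices $\boldsymbol\rho$: $$\min_{\hat{\mathbf v},\check{\mathbf v},\mathbf q\ge 0}\ \sum_{a\in\mathcal A}\int_0^{v_a}t_a(u)\,du+\frac1{\beta_1}\sum_{r\in\mathcal R}\sum_{s\in\mathcal S}q_{rs}\big(\ln q_{rs}-1-\beta_2\rho_s-\beta_{0,s}\big)\quad\text{subject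 to (F)}.$$ Single-level problem $\mathrm{(SL)}$: $$\min_{\hat{\mathbf v},\check{\mathbf v},\mathbf q,\mathbf d\ge 0}\ \frac{\beta_1}{\beta_2}\sum_{a\in\mathcal A}\int_0^{v_a}t_a(u)\,du+\frac1{\beta_2}\sum_{r\in\mathcal R}\sum_{s\in\mathcal S}q_{rs}\big(\ln q_{rs}-1-\beta_{0,s}\big)+\sum_{s\in\mathcal S}\frac1{b_s}\Big(\frac{d_s^2}{2}-D_sd_s\Big)$$ subject to (F) and $\sum_{r\in\mathcal R}q_{rs}=d_s$ for all $s\in\mathcal S$, the latter constraints having dual variables $\rho_s$. Conventions: $0\ln0=0$; the dual variables $\rho_s$ enter the Lagrangian of $\mathrm{(SL)}$ through the term $\sum_{s}\rho_s\big(d_s-\sum_r q_{rs}\big)$ added to the objective, and optimal dual variables are the corresponding Lagrange (KKT) multipliers at an optimal solution. *)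

(* Defs.v *)
From HB Require Import structures.
From mathcomp Require Import all_boot all_order all_algebra.
From mathcomp Require Import all_classical all_reals all_analysis.
Import Order.TTheory GRing.Theory Num.Theory.
Import numFieldNormedType.Exports.

Set Implicit Arguments.
Unset Strict Implicit.
Unset Printing Implicit Defensive.

Local Open Scope classical_set_scope.
Local Open Scope ring_scope.

(* Vectors indexed by drivers, riders or dests are total functions on nodes of
   which only the values on these sets are used.  Parallel links and links from
   a node to itself are allowed. *)
Record network (R : realType) (node link : finType) := Network {
  src : link -> node;
  tgt : link -> node;
  drivers : {set node};
  riders : {set node};
  dests : {set node};
  (* only the values on [0, +oo[ are used *)
  travel_time : link -> R -> R;
  driver_supply : node -> R;      (* Q_r *)
  departures : node -> R;         (* \bar D_s *)
  fraction : node -> node -> R;   (* \delta_{sk} *)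
  beta0 : node -> R;
  beta1 : R;
  beta2 : R;
  demand0 : node -> R;            (* D_s *)
  slope : node -> R               (* b_s *)
}.

(* \hat v_{rs,a}, \check v_{sk,a} and q_{rs} *)
Record flow (R : realType) (node link : finType) := Flow {
  vhat : node * node * link -> R;
  vcheck : node * node * link -> R;
  reloc : node * node -> R
}.

Section Model.
Context (R : realType) (node link : finType).
Variable G : network R node link.
Implicit Types (x : flow R node link) (rho d : node -> R).

Definition adjacent : rel node :=
  fun i j => [exists a, (src G a == i) && (tgt G a == j)].

Definition reachable (i j : node) : bool := connect adjacent i j.

(* The column of a link from a node to itself is 0. *)
Definition incidence (i : node) (a : link) : R :=
  (i == src G a)%:R - (i == tgt G a)%:R.

Definition od (i j : node) : node -> R :=
  fun k => (k == i)%:R - (k == j)%:R.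

(* \bar d_{sk} *)
Definition trips (s k : node) : R := fraction G s k * departures G s.

Definition link_flow x (a : link) : R :=
  \sum_(r in drivers G) \sum_(s in riders G) vhat x (r, s, a)
  + \sum_(s in riders G) \sum_(k in dests G) vcheck x (s, k, a).

Definition vhat_residual x (r s i : node) : R :=
  reloc x (r, s) * od r s i - \sum_a incidence i a * vhat x (r, s, a).

Definition vcheck_residual x (s k i : node) : R :=
  trips s k * od s k i - \sum_a incidence i a * vcheck x (s, k, a).

Definition supply_residual x (r : node) : R :=
  driver_supply G r - \sum_(s in riders G) reloc x (r, s).

Definition demand_residual x d (s : node) : R :=
  d s - \sum_(r in drivers G) reloc x (r, s).

Definition flow_nonneg x : Prop :=
  [/\ {in drivers G & riders G, forall r s a, 0 <= vhat x (r, s, a)},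
      {in riders G & dests G, forall s k a, 0 <= vcheck x (s, k, a)} &
      {in drivers G & riders G, forall r s, 0 <= reloc x (r, s)}].

Definition flow_feasible x : Prop :=
  [/\ flow_nonneg x,
      {in drivers G & riders G, forall r s i, vhat_residual x r s i = 0},
      {in riders G & dests G, forall s k i, vcheck_residual x s k i = 0} &
      {in drivers G, forall r, supply_residual x r = 0}].

Definition congestion_cost x : R :=
  \sum_a \int[lebesgue_measure]_(u in `[0, link_flow x a]) travel_time G a u.

(* LL: lower level, SL: single level.  The convention 0 * ln 0 = 0 holds
   because ln is total. *)
Definition LL_objective rho x : R :=
  congestion_cost x
  + (beta1 G)^-1 * \sum_(r in drivers G) \sum_(s in riders G)
      reloc x (r, s)
      * (ln (reloc x (r, s)) - 1 - beta2 G * rho s - beta0 G s).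

Definition LL_optimal rho x : Prop :=
  flow_feasible x /\
  forall x', flow_feasible x' -> LL_objective rho x <= LL_objective rho x'.

Definition bilevel_feasible rho (m : node -> R) : Prop :=
  exists2 x, LL_optimal rho x &
    {in riders G, forall s,
      m s = `|\sum_(r in drivers G) reloc x (r, s)
              - (demand0 G s - slope G s * rho s)|}.

Definition solves_bilevel rho : Prop :=
  exists2 m, bilevel_feasible rho m &
    forall rho' m', bilevel_feasible rho' m' ->
      \sum_(s in riders G) m s <= \sum_(s in riders G) m' s.

Definition SL_feasible x d : Prop :=
  [/\ flow_feasible x,
      {in riders G, forall s, 0 <= d s} &
      {in riders G, forall s, demand_residual x d s = 0}].

Definition SL_objective x d : R :=
  beta1 G / beta2 G * congestion_cost x
  + (beta2 G)^-1 * (\sum_(r in drivers G) \sum_(s in riders G)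
      reloc x (r, s) * (ln (reloc x (r, s)) - 1 - beta0 G s))
  + \sum_(s in riders G)
      (slope G s)^-1 * (d s ^+ 2 / 2 - demand0 G s * d s).

Definition SL_optimal x d : Prop :=
  SL_feasible x d /\
  forall x' d', SL_feasible x' d' -> SL_objective x d <= SL_objective x' d'.

(* Multipliers of the equality constraints in flow_feasible: the first two
   families are indexed by an O-D pair and a node, the third by a driver node. *)
Record multipliers := Multipliers {
  mult_vhat : node -> node -> node -> R;
  mult_vcheck : node -> node -> node -> R;
  mult_supply : node -> R
}.

Definition SL_lagrangian (l : multipliers) rho x d : R :=
  SL_objective x d
  + \sum_(s in riders G) rho s * demand_residual x d s
  + \sum_(r in drivers G) \sum_(s in riders G) \sum_i
      mult_vhat l r s i * vhat_residual x r s i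
  + \sum_(s in riders G) \sum_(k in dests G) \sum_i
      mult_vcheck l s k i * vcheck_residual x s k i
  + \sum_(r in drivers G) mult_supply l r * supply_residual x r.

(* phi has derivative g at y relative to [0, +oo[: a two-sided derivative if
   0 < y, a right derivative if y = 0.  The latter is needed because the
   objective is only meaningful for nonnegative arguments; there is none for
   z * ln z, whose slope at 0 is -oo. *)
Definition derivative_on_nonneg (phi : R -> R) (y g : R) : Prop :=
  (phi z - phi y) / (z - y) @[z --> within [set z | 0 <= z] y^'] --> g.

(* phi is the Lagrangian as a function of one nonnegative variable, of current
   value y; nu is the multiplier of the constraint that it be nonnegative. *)
Definition stationary (phi : R -> R) (y : R) : Prop :=
  exists nu, [/\ derivative_on_nonneg phi y nu, 0 <= nu & nu * y = 0].

Definition SL_KKT (l : multipliers) rho x d : Prop :=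
  [/\ {in drivers G & riders G, forall r s a, stationary
        (fun z => SL_lagrangian l rho
          (Flow [eta vhat x with (r, s, a) |-> z] (vcheck x) (reloc x)) d)
        (vhat x (r, s, a))},
      {in riders G & dests G, forall s k a, stationary
        (fun z => SL_lagrangian l rho
          (Flow (vhat x) [eta vcheck x with (s, k, a) |-> z] (reloc x)) d)
        (vcheck x (s, k, a))},
      {in drivers G & riders G, forall r s, stationary
        (fun z => SL_lagrangian l rho
          (Flow (vhat x) (vcheck x) [eta reloc x with (r, s) |-> z]) d)
        (reloc x (r, s))} &
      {in riders G, forall s, stationary
        (fun z => SL_lagrangian l rho x [eta d with s |-> z]) (d s)}].

(* Primal feasibility, the remaining KKT condition, is part of SL_optimal. *)
Definition SL_optimal_dual rho : Prop :=
  exists x d, SL_optimal x d /\ exists l, SL_KKT l rho x d.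

End Model.

(* Main.v *)
(* Substituting d_s = sum_r q_rs, the objectives of (LL(rho)) and (SL) become,
   up to a positive factor, the same convex potential except for a separable
   term psi_s in the arrivals at s: -rho_s d for (LL), (d^2/2 - D_s d)/b_s for
   (SL).  The minimizers of such a potential are positive relocation flows
   (the slope of q ln q at 0 is -oo, and reachability provides an interior
   feasible flow) satisfying a variational inequality which depends on psi only
   through the prices rho_s = - psi_s'(d_s).  Hence a flow that is optimal for
   (SL) is optimal for (LL(rho)) with rho_s = (D_s - d_s)/b_s, which makes all
   m_s vanish; as (SL) has a solution by coercivity, the optimal bilevel value
   is 0.  So rho solves the bilevel problem iff the variational inequality with
   prices rho holds at a flow with d_s = D_s - b_s rho_s, and by Farkas' lemma
   this is equivalent to the KKT conditions of (SL) with multipliers rho. *)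
Require Import Defs.
From HB Require Import structures.
From mathcomp Require Import all_boot all_order all_algebra.
From mathcomp Require Import all_classical all_reals all_analysis.
From mathcomp Require Import ring lra.
Import Order.TTheory GRing.Theory Num.Theory.
Import numFieldNormedType.Exports.

Set Implicit Arguments.
Unset Strict Implicit.
Unset Printing Implicit Defensive.

Local Open Scope classical_set_scope.
Local Open Scope ring_scope.

(** * Farkas' lemma *)

(** The obstacle is that [z * ln z] has no slope at 0, while the total function [ln] takes the value
    0 there: where a relocation flow vanishes, the formula [marginal] is meaningful only in
    directions that leave this flow at 0. The argument therefore rests on subgradient inequalities
    instead of derivatives. They are proved for each one-variable term (the travel-time integral,
    [z * ln z], the term in the arrivals) and added up. Applied at an interior point of a segment
    and directed back to a minimizer at its end, they give first-order conditions even before the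
    minimizer is known to be positive; positivity then allows the passage to the limit at the end
    point. Where the subgradient is continuous they also give back the derivatives which the KKT
    conditions ask for. Once the relocation flows are positive, the only active inequalities are
    those of vanishing link flows; all constraints being linear, Farkas' lemma on the vector space
    of flows yields multipliers without a further constraint qualification. *)

Section Scalar.
Context {R : pzRingType} {V : lmodType R}.
Implicit Types (f : V -> R) (x y : V).

Lemma scalar_line f x y c : scalar f -> f (x + c *: y) = f x + c * f y.
Proof. by move=> lf; rewrite addrC lf addrC. Qed.

Lemma scalarB f x y : scalar f -> f (y - x) = f y - f x.
Proof. by move=> lf; rewrite -scaleN1r scalar_line// mulN1r. Qed.

Lemma scalar_scale f c x : scalar f -> f (c *: x) = c * f x.
Proof.
move=> lf; rewrite -[c *: x]add0r scalar_line// -(subrr x) scalarB//.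
by rewrite subrr add0r.
Qed.

End Scalar.

Section Farkas.
Context (R : realFieldType) (V : lmodType R).

(* Bartl's induction: if [b] is negative at some [x0] on which all [a i] but
   [a j] are nonnegative, the functionals [f x + a j x * f x0], where [x0] is
   scaled so that [a j x0 = -1], satisfy the hypothesis without [a j]. *)
Lemma farkas (J : eqType) (s : seq J) (a : J -> V -> R) (b : V -> R) :
  uniq s -> (forall j, scalar (a j)) -> scalar b ->
  (forall x, {in s, forall j, 0 <= a j x} -> 0 <= b x) ->
  exists2 l : J -> R, forall j, 0 <= l j &
    forall x, b x = \sum_(j <- s) l j * a j x.
Proof.
elim: s a b => [|j s IHs] a b /=.
  move=> _ _ lb b0; exists (fun=> 0) => // x; rewrite big_nil.
  (* With no constraints left, [b] is nonnegative at [x] and at [- x], the latter written as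
     [- 2 *: x + x] to match the shape of [scalar]; hence [b x = 0]. *)
  have := b0 x; have := b0 (- 2 *: x + x).
  rewrite lb => /(_ (fun _ => ltac:(done))) h1 /(_ (fun _ => ltac:(done))) h2.
  lra.
move=> /andP[js us] la lb b0.
have sumE (l : J -> R) c x :
  \sum_(i <- s) (if i == j then c else l i) * a i x
  = \sum_(i <- s) l i * a i x.
  by apply: eq_big_seq => i si; case: eqP => // ij; rewrite -ij si in js.
have [bs|] := pselect (forall x, {in s, forall i, 0 <= a i x} -> 0 <= b x).
  have [l l0 bE] := IHs a b us la lb bs.
  exists (fun i => if i == j then 0 else l i) => [i|x]; first by case: ifP.
  by rewrite big_cons eqxx mul0r add0r sumE.
move=> /existsNP[x1 /not_implyP[x1s /negP]]; rewrite -ltNge => bx1.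
have ajx1 : a j x1 < 0.
  rewrite ltNge; apply/negP => ajx1; move: bx1; rewrite ltNge => /negP; apply.
  by apply: b0 => i; rewrite inE => /predU1P[->|/x1s].
pose x0 := (- a j x1)^-1 *: x1.
have c0 : 0 < (- a j x1)^-1 by rewrite invr_gt0 oppr_gt0.
have x0s i : i \in s -> 0 <= a i x0.
  by move=> si; rewrite scalar_scale// mulr_ge0 ?x1s// ltW.
have bx0 : b x0 < 0 by rewrite scalar_scale// pmulr_rlt0.
have ajx0 : a j x0 = -1.
  by rewrite scalar_scale// invrN mulNr mulVf// lt_eqF.
pose pr (f : V -> R) x := f x + a j x * f x0.
have prE f x : scalar f -> pr f x = f (a j x *: x0 + x).
  by move=> lf; rewrite lf addrC.
have lpr f : scalar f -> scalar (pr f).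
  by move=> lf c u v; rewrite /pr lf la; ring.
have [x xs|l l0 bE] := IHs (fun i => pr (a i)) (pr b) us
    (fun i => lpr _ (la i)) (lpr _ lb).
  rewrite prE//; apply: b0 => i; rewrite inE => /predU1P[->|si].
    by rewrite la ajx0 mulrN1 addNr.
  by rewrite -prE// xs.
(* The multiplier of [a j] is found by expanding [pr b x = \sum l i * pr (a i) x] and collecting the
   terms in [a j x]; it is nonnegative because [a i x0 >= 0] and [b x0 < 0]. *)
exists (fun i => if i == j then \sum_(i <- s) l i * a i x0 - b x0 else l i).
  move=> i; case: ifP => // _; rewrite subr_ge0 (le_trans (ltW bx0))//.
  by rewrite big_seq sumr_ge0// => k ks; rewrite mulr_ge0 ?x0s.
move=> x; rewrite big_cons eqxx sumE.
have -> : b x = pr b x - a j x * b x0 by rewrite /pr addrK.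
rewrite bE; have -> : \sum_(i <- s) l i * pr (a i) x
    = \sum_(i <- s) l i * a i x + (\sum_(i <- s) l i * a i x0) * a j x.
  by rewrite mulr_suml -big_split/=; apply: eq_bigr => i _; rewrite /pr; ring.
ring.
Qed.

(** Each equality enters as two opposite inequalities, and the difference of their two multipliers
    is free in sign. *)
Lemma farkas_eq (J K : finType) (P : pred J) (Q : pred K)
    (a : J -> V -> R) (e : K -> V -> R) (b : V -> R) :
  (forall j, scalar (a j)) -> (forall k, scalar (e k)) -> scalar b ->
  (forall x, (forall j, P j -> 0 <= a j x) -> (forall k, Q k -> e k x = 0) ->
     0 <= b x) ->
  exists l m, (forall j, 0 <= l j) /\
    forall x, b x = \sum_(j | P j) l j * a j x + \sum_(k | Q k) m k * e k x.
Proof.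
move=> la le lb b0.
pose A (i : J + (K + K)) := match i with
  | inl j => a j | inr (inl k) => e k | inr (inr k) => fun x => - e k x end.
pose S (i : J + (K + K)) := match i with
  | inl j => P j | inr (inl k) => Q k | inr (inr k) => Q k end.
have [|x xS|l l0 bE] := @farkas _ (enum S) A b (enum_uniq S) _ lb.
- case=> [j|[k|k]] //= c u v.
  by rewrite le opprD mulrN.
- apply: b0 => [j Pj|k Qk]; first by apply: (xS (inl j)); rewrite mem_enum.
  apply/eqP; rewrite eq_le -oppr_ge0; apply/andP; split.
    by apply: (xS (inr (inr k))); rewrite mem_enum.
  by apply: (xS (inr (inl k))); rewrite mem_enum.
exists (l \o inl), (fun k => l (inr (inl k)) - l (inr (inr k))).
split=> [j|x]; first exact: l0.
rewrite bE big_enum big_sumType big_sumType /= -big_split/=.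
congr (_ + _); apply: eq_bigr => k _; rewrite mulrN; ring.
Qed.

End Farkas.

(** * Convex functions on the nonnegative half-line *)

Section ConvexOnNonneg.
Context {R : realType}.
Implicit Types (phi g f : R -> R) (y v w z : R).

Local Notation nonneg := [set z : R | 0 <= z].

Lemma near_nonneg (P : R -> Prop) y : (forall z, 0 <= z -> P z) ->
  \forall z \near within nonneg (nbhs y), P z.
Proof.
move=> h; suff : nbhs y [set z | 0 <= z -> P z] by [].
by apply: filterE.
Qed.

Lemma at_right_nonneg y : 0 <= y -> at_right y `=>` within nonneg y^'.
Proof.
move=> y0 A hA; have {}hA : nbhs y [set z | z != y -> 0 <= z -> A z] := hA.
apply: (@filterS _ (nbhs y) _ _ [set z | y < z -> A z] _ hA) => z h yz.
by apply: h; rewrite ?gt_eqF//= (le_trans y0)// ltW.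
Qed.

Lemma nonneg_punctured_proper y : 0 <= y ->
  ProperFilter (within nonneg y^').
Proof.
move=> y0; split; last exact: within_filter.
by move=> /(at_right_nonneg y0)/filter_ex[].
Qed.

Lemma derivative_on_nonneg_uniq phi y l l' : 0 <= y ->
  derivative_on_nonneg phi y l -> derivative_on_nonneg phi y l' -> l = l'.
Proof.
move=> /nonneg_punctured_proper ? h h'.
by apply: (@cvg_unique R^o _ _ _ l l' h h'); exact: norm_hausdorff.
Qed.

(** The two subgradient inequalities place the difference quotient between [g y] and [g z], so
    continuity of [g] at [y] suffices. They are required only near [y], because positivity of a
    relocation flow persists only locally. *)
Lemma derivative_of_subgradient phi g y : 0 <= y ->
  (\forall z \near within nonneg (nbhs y),
     g y * (z - y) <= phi z - phi y /\ g z * (y - z) <= phi y - phi z) ->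
  g @ within nonneg (nbhs y) --> g y ->
  derivative_on_nonneg phi y (g y).
Proof.
move=> y0 ineq cg; rewrite /derivative_on_nonneg.
have sub : within nonneg y^' `=>` within nonneg (nbhs y).
  move=> A hA.
  by apply: (@filterS _ (nbhs y) _ _ [set z | z != y -> 0 <= z -> A z] _ hA) => z h _.
have {}cg : g @ within nonneg y^' --> g y by apply: cvg_trans cg; exact: cvg_app.
have FF := nonneg_punctured_proper y0.
have neqy : \forall z \near within nonneg y^', z != y.
  suff : nbhs y [set z | z != y -> 0 <= z -> z != y] by [].
  apply: filterE => z. by move=> /= h _.
apply/cvgrPdist_le => e e0; near=> z.
have zy : z != y.
  by near: z.
have [h1 h2] : g y * (z - y) <= phi z - phi y /\ g z * (y - z) <= phi y - phi z.
  by near: z; exact: sub.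
apply: (@le_trans _ _ `|g y - g z|); last first.
  by near: z; move/cvgrPdist_le: cg; apply.
have : phi z - phi y = (phi z - phi y) / (z - y) * (z - y).
  by rewrite mulfVK// subr_eq0.
move: (_ / _) => q Dq; move: h2; rewrite -(opprB (phi z)) -(opprB z) mulrN lerN2.
move: h1; rewrite Dq; rewrite -subr_eq0 in zy.
have [u0|u0|u0] := ltgtP (z - y) 0; last by rewrite u0 eqxx in zy.
  rewrite !ler_nM2r// => h1 h2; rewrite !ger0_norm ?subr_ge0//.
    by rewrite lerD2l lerN2.
  exact: le_trans h1.
rewrite !ler_pM2r// => h1 h2; rewrite distrC (distrC (g y)).
rewrite !ger0_norm ?subr_ge0//; first by rewrite lerD2r.
exact: le_trans h2.
Unshelve. all: end_near. Qed.

(** The increment [phi w - phi v] is squeezed between [g v * (w - v)] and [g w * (w - v)]. *)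
Lemma continuous_of_subgradient phi g :
  (forall v w, 0 <= v -> 0 <= w -> g v * (w - v) <= phi w - phi v) ->
  {within nonneg, continuous g} -> {within nonneg, continuous phi}.
Proof.
move=> ineq /subspace_continuousP cg; apply/subspace_continuousP => v v0.
have dist : w - v @[w --> within nonneg (nbhs v)] --> (0 : R).
  rewrite -(subrr v); apply: cvgB; [exact: cvg_within|exact: cvg_cst].
suff : phi w - phi v @[w --> within nonneg (nbhs v)] --> (0 : R).
  move=> /(cvgD (cvg_cst (phi v))) h; rewrite addr0 in h.
  by apply: cvg_trans h; apply: near_eq_cvg; apply: nearW => w; rewrite addrC subrK.
apply: (@squeeze_cvgr _ _ _ _ (fun w => g v * (w - v)) (fun w => g w * (w - v))).
- rewrite near_withinE; near=> w => w0; rewrite ineq//=.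
  by rewrite -lerN2 opprB -mulrN opprB ineq.
- by have := cvgM (cvg_cst (g v)) dist; rewrite mulr0; apply.
- by have := cvgM (cg v v0) dist; rewrite mulr0; apply.
Unshelve. all: end_near. Qed.

Lemma cvg_comp_nonneg {T : Type} {F : set_system T} {FF : Filter F}
    (h : R -> R) (f : T -> R) v :
  {within nonneg, continuous h} -> 0 <= v -> (\forall t \near F, 0 <= f t) ->
  f @ F --> v -> h (f t) @[t --> F] --> h v.
Proof.
move=> /subspace_continuousP ch v0 f0 fv.
apply: (@cvg_comp _ _ _ f h F (within nonneg (nbhs v))); last exact: ch.
move=> A hA; have {}hA : nbhs v [set z | 0 <= z -> A z] := hA.
by apply: (filterS2 _ _ f0 (fv _ hA)) => t t0; apply.
Qed.

Lemma ln_sub1 z : 0 < z -> ln z <= z - 1.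
Proof.
move=> z0; have -> : ln z = ln (1 + (z - 1)) by congr ln; ring.
by rewrite le_ln1Dx//; lra.
Qed.

(** [ln] is the derivative of [z * (ln z - 1)]. For [w > 0] the inequality is
    [ln (v / w) <= v / w - 1] multiplied by [w]. *)
Lemma xlnx_subgradient v w : 0 < v -> 0 <= w ->
  ln v * (w - v) <= w * (ln w - 1) - v * (ln v - 1).
Proof.
move=> v0; rewrite le_eqVlt => /predU1P[<-|w0]; first by lra.
have := ln_sub1 (divr_gt0 v0 w0); rewrite ln_div ?posrE//.
rewrite -(ler_pM2l w0) !mulrBr mulrCA divff ?gt_eqF// mulr1; nra.
Qed.

Lemma xlnx_continuous : {within nonneg, continuous (fun z => z * ln z : R)}.
Proof.
apply/subspace_continuousP => v /=; rewrite le_eqVlt => /predU1P[<-|v0]; last first.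
  apply: cvgM; first exact: cvg_within.
  by apply: cvg_trans (continuous_ln v0); apply: cvg_app; exact: cvg_within.
suff : w * ln w @[w --> within nonneg (nbhs 0)] --> (0 : R).
  by rewrite /from_subspace mul0r.
(* With [s = Num.sqrt w], the inequality [ln s^-1 <= s^-1 - 1] gives [s * ln s >= s - 1], hence
   [w * ln w = 2 * s * (s * ln s) >= - 2 * s]; the upper bound comes from [ln w < w]. *)
apply: (@squeeze_cvgr _ _ _ _ (fun w => - 2 * Num.sqrt w) (fun w => w * w)).
- rewrite near_withinE; near=> w => /=.
  rewrite le_eqVlt => /predU1P[<-|w0]; first by rewrite sqrtr0 !mul0r mulr0 lexx.
  rewrite ler_pM2l// (ltW (ln_sublinear w0)) andbT.
  have s0 : 0 < Num.sqrt w by rewrite sqrtr_gt0.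
  move: (esym (sqr_sqrtr (ltW w0))) s0; move: (Num.sqrt w) => s -> s0.
  have := ln_sub1 (_ : 0 < s^-1); rewrite invr_gt0 => /(_ s0).
  rewrite lnV ?posrE// -(ler_pM2l s0) mulrBr divff ?gt_eqF// mulr1 lnXn//.
  by rewrite -mulr_natl; nra.
- have sq : Num.sqrt w @[w --> within nonneg (nbhs 0)] --> (0 : R).
    rewrite -[X in _ --> X](@sqrtr0 R); apply: cvg_trans (@sqrt_continuous R 0).
    by apply: cvg_app; exact: cvg_within.
  by have := cvgM (cvg_cst (- 2 : R)) sq; rewrite mulr0; apply.
- have id0 : w @[w --> within nonneg (nbhs 0)] --> (0 : R) by exact: cvg_within.
  by have := cvgM id0 id0; rewrite mulr0; apply.
Unshelve. all: end_near. Qed.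

(** * The travel-time integral as a convex function *)

Section Integral.
Variable t : R -> R.
Hypothesis t_continuous : {within `[0, +oo[, continuous t}.
Hypothesis t_homo : forall v w, 0 <= v -> v <= w -> t v <= t w.

Lemma within_itv_nonneg : {within nonneg, continuous t}.
Proof. by move: t_continuous; rewrite set_itvE. Qed.

Lemma integrable_itv0 v w : 0 <= v ->
  lebesgue_measure.-integrable `[v, w] (EFin \o t).
Proof.
move=> v0; apply: continuous_compact_integrable; first exact: segment_compact.
apply: continuous_subspaceW t_continuous.
by move=> z /=; rewrite !in_itv/= andbT => /andP[/(le_trans v0)].
Qed.

Lemma Rintegral_diff v w : 0 <= v -> v <= w ->
  \int[lebesgue_measure]_(u in `[0, w]) t u
  - \int[lebesgue_measure]_(u in `[0, v]) t u
  = \int[lebesgue_measure]_(u in `[v, w]) t u.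
Proof.
move=> v0 vw; rewrite Rintegral_itvB ?bnd_simp//; last exact: integrable_itv0.
rewrite Rintegral_itv_obnd_cbnd//.
apply: integrableS (integrable_itv0 w v0) => //.
by move=> z /=; rewrite !in_itv/= => /andP[/ltW -> ->].
Qed.

(** The increment is, up to sign, the integral of [t] between [v] and [w], where monotonicity
    compares [t] with the constant [t v]: from below if [v <= w], from above otherwise. *)
Lemma Rintegral_subgradient v w : 0 <= v -> 0 <= w ->
  t v * (w - v) <= \int[lebesgue_measure]_(u in `[0, w]) t u
                   - \int[lebesgue_measure]_(u in `[0, v]) t u.
Proof.
have cstE (a b c : R) : a <= b ->
    c * (b - a) = \int[lebesgue_measure]_(u in `[a, b]) (fun=> c) u.
  move=> ab; rewrite Rintegral_cst//= lebesgue_measure_itv/= lte_fin.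
  by move: ab; rewrite le_eqVlt => /predU1P[->|->]//; rewrite ltxx subrr mulr0.
have intc (a b c : R) : lebesgue_measure.-integrable `[a, b] (EFin \o (fun=> c)).
  apply: continuous_compact_integrable; first exact: segment_compact.
  by move=> ?; exact: cvg_cst.
move=> v0 w0; have [vw|/ltW wv] := leP v w.
  rewrite Rintegral_diff// cstE//; apply: le_Rintegral => //.
    exact: integrable_itv0.
  by move=> z /=; rewrite in_itv/= => /andP[vz _]; exact: t_homo.
rewrite -lerN2 -mulrN !opprB Rintegral_diff// cstE//.
apply: le_Rintegral => //; first exact: integrable_itv0.
by move=> z /=; rewrite in_itv/= => /andP[wz zv]; rewrite t_homo// (le_trans w0).
Qed.

End Integral.
End ConvexOnNonneg.

(** * The vector space of flows and the potential *)

Lemma scalar_sum {R : comPzRingType} {V : lmodType R} (I : finType)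
    (P : pred I) (c : I -> R) (f : I -> V -> R) :
  (forall i, scalar (f i)) -> scalar (fun x => \sum_(i | P i) c i * f i x).
Proof.
move=> lf k x y; rewrite mulr_sumr -big_split/=; apply: eq_bigr => i _.
by rewrite lf mulrDr mulrCA.
Qed.

Lemma scalar_sum1 {R : comPzRingType} {V : lmodType R} (I : finType)
    (P : pred I) (f : I -> V -> R) :
  (forall i, scalar (f i)) -> scalar (fun x => \sum_(i | P i) f i x).
Proof.
move=> lf k x y; rewrite mulr_sumr -big_split/=; apply: eq_bigr => i _.
by rewrite lf.
Qed.

Section FlowModule.
Context {R : realType} {node link : finType}.
Local Notation flow := (flow R node link).
Implicit Types x y z : flow.

(** Flows are records of functions, so equality and choice are the classical ones. The module
    structure lets segments of flows be written [x + t *: (y - x)] and flows serve as the vectors in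
    Farkas' lemma. *)
HB.instance Definition _ := gen_eqMixin flow.
HB.instance Definition _ := gen_choiceMixin flow.

Lemma flowP x y : vhat x =1 vhat y -> vcheck x =1 vcheck y ->
  reloc x =1 reloc y -> x = y.
Proof.
by case: x y => [? ? ?] [? ? ?] /= /funext -> /funext -> /funext ->.
Qed.

Definition flow_zero : flow := Flow (fun=> 0) (fun=> 0) (fun=> 0).
Definition flow_opp x : flow := Flow (fun p => - vhat x p)
  (fun p => - vcheck x p) (fun p => - reloc x p).
Definition flow_add x y : flow := Flow (fun p => vhat x p + vhat y p)
  (fun p => vcheck x p + vcheck y p) (fun p => reloc x p + reloc y p).
Definition flow_scale (c : R) x : flow := Flow (fun p => c * vhat x p)
  (fun p => c * vcheck x p) (fun p => c * reloc x p).

Lemma flow_addA : associative flow_add.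
Proof. by move=> x y z; apply: flowP => p /=; rewrite addrA. Qed.
Lemma flow_addC : commutative flow_add.
Proof. by move=> x y; apply: flowP => p /=; rewrite addrC. Qed.
Lemma flow_add0 : left_id flow_zero flow_add.
Proof. by move=> x; apply: flowP => p /=; rewrite add0r. Qed.
Lemma flow_addN : left_inverse flow_zero flow_opp flow_add.
Proof. by move=> x; apply: flowP => p /=; rewrite addNr. Qed.

HB.instance Definition _ :=
  GRing.isZmodule.Build flow flow_addA flow_addC flow_add0 flow_addN.

Lemma flow_scaleA c d x : flow_scale c (flow_scale d x) = flow_scale (c * d) x.
Proof. by apply: flowP => p /=; rewrite mulrA. Qed.
Lemma flow_scale1 : left_id 1 flow_scale.
Proof. by move=> x; apply: flowP => p /=; rewrite mul1r. Qed.
Lemma flow_scaleDr : right_distributive flow_scale +%R.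
Proof. by move=> c x y; apply: flowP => p /=; rewrite mulrDr. Qed.
Lemma flow_scaleDl x : {morph flow_scale^~ x : c d / c + d >-> c + d}.
Proof. by move=> c d; apply: flowP => p /=; rewrite mulrDl. Qed.

HB.instance Definition _ := GRing.Zmodule_isLmodule.Build R flow
  flow_scaleA flow_scale1 flow_scaleDr flow_scaleDl.

Lemma reloc_scalar p : scalar (fun x : flow => reloc x p).
Proof. by []. Qed.

End FlowModule.

Section Network.
Context {R : realType} {node link : finType}.
Variable G : network R node link.
Local Notation flow := (flow R node link).
Implicit Types (x y e : flow) (rho d : node -> R) (psi dpsi : node -> R -> R).

Lemma link_flow_scalar a : scalar (fun x => link_flow G x a).
Proof.
move=> c x y; rewrite /link_flow mulrDr addrACA.
by congr (_ + _);
  do 2 (rewrite mulr_sumr -big_split/=; apply: eq_bigr => ? _).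
Qed.

Definition arrivals x s : R := \sum_(r in drivers G) reloc x (r, s).

Lemma arrivals_scalar s : scalar (fun x => arrivals x s).
Proof. exact: scalar_sum1. Qed.

Definition sent x r : R := \sum_(s in riders G) reloc x (r, s).

Lemma sent_scalar r : scalar (fun x => sent x r).
Proof. exact: scalar_sum1. Qed.

(** [vcheck_residual] and [supply_residual] contain fixed data and are only affine; [vcheck_net] and
    [sent] are the negatives of their linear parts. [vhat_residual] is itself linear, as [q_rs] is a
    variable. *)
Definition vcheck_net x s k i : R := \sum_a incidence G i a * vcheck x (s, k, a).

Lemma vcheck_net_scalar s k i : scalar (fun x => vcheck_net x s k i).
Proof. exact: scalar_sum. Qed.

Lemma vhat_residual_scalar r s i : scalar (fun x => vhat_residual G x r s i).
Proof.
move=> c x y; rewrite /vhat_residual [c * (_ - _)]mulrBr addrACA -opprD; congr (_ - _).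
  by rewrite /= mulrDl mulrA.
by apply: (scalar_sum _ _ (f := fun a x => vhat x (r, s, a))).
Qed.

Lemma flow_nonneg_segment x y t : 0 <= t <= 1 ->
  flow_nonneg G x -> flow_nonneg G y -> flow_nonneg G (x + t *: (y - x)).
Proof.
move=> /andP[t0 t1] [x1 x2 x3] [y1 y2 y3].
have seg (u v : R) : 0 <= u -> 0 <= v -> 0 <= u + t * (v - u).
  move=> u0 v0; have -> : u + t * (v - u) = (1 - t) * u + t * v by ring.
  by rewrite addr_ge0// mulr_ge0// subr_ge0.
split=> [r s rD sR a|s k sR kK a|r s rD sR]; apply: seg.
- exact: x1. - exact: y1. - exact: x2. - exact: y2. - exact: x3. - exact: y3.
Qed.

Lemma vcheck_residualE x s k i :
  vcheck_residual G x s k i = trips G s k * od R s k i - vcheck_net x s k i.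
Proof. by []. Qed.

Lemma supply_residualE x r : supply_residual G x r = driver_supply G r - sent x r.
Proof. by []. Qed.

Lemma flow_feasible_segment x y t : 0 <= t <= 1 ->
  flow_feasible G x -> flow_feasible G y -> flow_feasible G (x + t *: (y - x)).
Proof.
move=> t01 [x1 x2 x3 x4] [y1 y2 y3 y4]; split; first exact: flow_nonneg_segment.
- move=> r s rD sR i; rewrite (scalar_line _ _ _ (@vhat_residual_scalar r s i)).
  by rewrite (scalarB _ _ (@vhat_residual_scalar r s i)) x2// y2// subrr mulr0 addr0.
- move=> s k sR kK i; rewrite vcheck_residualE.
  rewrite (scalar_line _ _ _ (@vcheck_net_scalar s k i)).
  rewrite (scalarB _ _ (@vcheck_net_scalar s k i)).
  have := x3 s k sR kK i; have := y3 s k sR kK i; rewrite !vcheck_residualE.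
  by move=> /eqP; rewrite subr_eq0 => /eqP <- /eqP; rewrite subr_eq0 => /eqP <-; ring.
- move=> r rD; rewrite supply_residualE.
  rewrite (scalar_line _ _ _ (@sent_scalar r)) (scalarB _ _ (@sent_scalar r)).
  have := x4 r rD; have := y4 r rD; rewrite !supply_residualE.
  by move=> /eqP; rewrite subr_eq0 => /eqP <- /eqP; rewrite subr_eq0 => /eqP <-; ring.
Qed.

Lemma link_flow_ge0 x a : flow_nonneg G x -> 0 <= link_flow G x a.
Proof.
move=> [x1 x2 _]; apply: addr_ge0; apply: sumr_ge0 => i iP; apply: sumr_ge0 => j jP.
  exact: x1.
exact: x2.
Qed.

Lemma arrivals_ge0 x s : s \in riders G -> flow_nonneg G x -> 0 <= arrivals x s.
Proof. by move=> sR [_ _ x3]; apply: sumr_ge0 => r rD; exact: x3. Qed.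

Definition potential psi x : R :=
  beta1 G / beta2 G * congestion_cost G x
  + (beta2 G)^-1 * (\sum_(r in drivers G) \sum_(s in riders G)
      reloc x (r, s) * (ln (reloc x (r, s)) - 1 - beta0 G s))
  + \sum_(s in riders G) psi s (arrivals x s).

(* The derivative at [x] in the direction [e] of the potential with
   [psi s v = - rho s * v]. *)
Definition marginal rho x e : R :=
  \sum_a beta1 G / beta2 G * travel_time G a (link_flow G x a) * link_flow G e a
  + \sum_(r in drivers G) \sum_(s in riders G)
      ((beta2 G)^-1 * (ln (reloc x (r, s)) - beta0 G s) - rho s) * reloc e (r, s).

Lemma marginal_scalar rho x : scalar (marginal rho x).
Proof.
move=> c e e'; rewrite /marginal mulrDr addrACA; congr (_ + _).
  apply: (scalar_sum _ _ (f := fun a e => link_flow G e a)) link_flow_scalar _ _ _.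
rewrite mulr_sumr -big_split/=; apply: eq_bigr => r _.
by apply: (scalar_sum _ _ (f := fun s e => reloc e (r, s))).
Qed.

Lemma marginalE rho x e : marginal rho x e =
    beta1 G / beta2 G * (\sum_a travel_time G a (link_flow G x a) * link_flow G e a)
  + (beta2 G)^-1 * (\sum_(r in drivers G) \sum_(s in riders G)
      (ln (reloc x (r, s)) - beta0 G s) * reloc e (r, s))
  + \sum_(s in riders G) - rho s * arrivals e s.
Proof.
rewrite /marginal -addrA; congr (_ + _).
  by rewrite mulr_sumr; apply: eq_bigr => a _; rewrite mulrA.
rewrite mulr_sumr [X in _ = _ + X](_ : _ = \sum_(r in drivers G)
  \sum_(s in riders G) - rho s * reloc e (r, s)).
  rewrite -big_split/=; apply: eq_bigr => r _.
  rewrite mulr_sumr -big_split/=; apply: eq_bigr => s _; ring.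
by rewrite [RHS]exchange_big/=; apply: eq_bigr => s _; rewrite mulr_sumr.
Qed.

Lemma eq_marginal rho rho' x e : {in riders G, rho =1 rho'} ->
  marginal rho x e = marginal rho' x e.
Proof.
move=> eqr; congr (_ + _); apply: eq_bigr => r _; apply: eq_bigr => s sR.
by rewrite eqr.
Qed.

Lemma potential_linearE rho x : beta1 G != 0 -> beta2 G != 0 ->
  potential (fun s v => - rho s * v) x
  = beta1 G / beta2 G * LL_objective G rho x.
Proof.
move=> b1 b2; rewrite /potential /LL_objective.
have -> : \sum_(s in riders G) - rho s * arrivals x s
    = - \sum_(r in drivers G) \sum_(s in riders G) rho s * reloc x (r, s).
  rewrite exchange_big -sumrN; apply: eq_bigr => s _.
  by rewrite mulNr mulr_sumr.
have -> : \sum_(r in drivers G) \sum_(s in riders G) reloc x (r, s)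
      * (ln (reloc x (r, s)) - 1 - beta2 G * rho s - beta0 G s)
    = \sum_(r in drivers G) \sum_(s in riders G)
        reloc x (r, s) * (ln (reloc x (r, s)) - 1 - beta0 G s)
      - beta2 G * \sum_(r in drivers G) \sum_(s in riders G) rho s * reloc x (r, s).
  rewrite mulr_sumr -sumrB; apply: eq_bigr => r _.
  by rewrite mulr_sumr -sumrB; apply: eq_bigr => s _; ring.
by field; rewrite b1 b2.
Qed.

Lemma SL_objectiveE x d :
  {in riders G, forall s, demand_residual G x d s = 0} ->
  SL_objective G x d = potential
    (fun s v => (slope G s)^-1 * (v ^+ 2 / 2 - demand0 G s * v)) x.
Proof.
move=> dx; congr (_ + _); apply: eq_bigr => s sR.
by have /eqP := dx s sR; rewrite subr_eq0 => /eqP ->.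
Qed.

Hypothesis time_continuous :
  forall a, {within `[0, +oo[, continuous (travel_time G a)}.
Hypothesis time_increasing :
  forall a u v, 0 <= u -> u < v -> travel_time G a u < travel_time G a v.
Hypothesis beta1_gt0 : 0 < beta1 G.
Hypothesis beta2_gt0 : 0 < beta2 G.

Lemma time_homo a v w : 0 <= v -> v <= w -> travel_time G a v <= travel_time G a w.
Proof.
by move=> v0; rewrite le_eqVlt => /predU1P[->//|vw]; rewrite ltW// time_increasing.
Qed.

(** The inequality holds term by term. The alternative on [reloc x] is what makes the logarithmic
    terms valid: [ln (reloc x (r, s))] is a subgradient where the flow is positive, and where the
    flow is the same in [x] and [y] both sides of the term vanish. *)
Lemma potential_subgradient psi dpsi x y :
  {in riders G, forall s v w, 0 <= v -> 0 <= w ->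
     dpsi s v * (w - v) <= psi s w - psi s v} ->
  flow_nonneg G x -> flow_nonneg G y ->
  {in drivers G & riders G, forall r s,
     0 < reloc x (r, s) \/ reloc x (r, s) = reloc y (r, s)} ->
  marginal (fun s => - dpsi s (arrivals x s)) x (y - x)
    <= potential psi y - potential psi x.
Proof.
move=> hpsi x0 y0 qx.
rewrite marginalE; under eq_bigr do rewrite (scalarB _ _ (link_flow_scalar _)).
under [X in _ + X <= _]eq_bigr do rewrite opprK (scalarB _ _ (@arrivals_scalar _)).
rewrite /potential !opprD !addrA -!addrA.
rewrite [X in _ <= X](_ : _ =
    beta1 G / beta2 G * (congestion_cost G y - congestion_cost G x)
  + ((beta2 G)^-1 * (\sum_(r in drivers G) \sum_(s in riders G)
      (reloc y (r, s) * (ln (reloc y (r, s)) - 1 - beta0 G s)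
       - reloc x (r, s) * (ln (reloc x (r, s)) - 1 - beta0 G s)))
  + \sum_(s in riders G) (psi s (arrivals y s) - psi s (arrivals x s)))); last first.
  rewrite sumrB; under [in RHS]eq_bigr do rewrite sumrB.
  by rewrite sumrB; ring.
apply: lerD; [|apply: lerD].
- rewrite ler_pM2l ?divr_gt0// /congestion_cost -sumrB; apply: ler_sum => a _.
  by apply: Rintegral_subgradient => //; [exact: time_homo| |]; exact: link_flow_ge0.
- rewrite ler_pM2l ?invr_gt0//; apply: ler_sum => r rD; apply: ler_sum => s sR.
  have [x3 y3] : 0 <= reloc x (r, s) /\ 0 <= reloc y (r, s).
    by case: x0 y0 => _ _ x3 [_ _ y3]; split; [exact: x3|exact: y3].
  rewrite (_ : reloc (y - x) (r, s) = reloc y (r, s) - reloc x (r, s))//.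
  case: (qx r s rD sR) => [q0|->]; last by rewrite !subrr mulr0.
  by have := xlnx_subgradient q0 y3; lra.
- by apply: ler_sum => s sR; apply: hpsi => //; exact: arrivals_ge0.
Qed.

End Network.

(** * Minimizers of the potential and variational inequalities *)

Lemma ler_sum_elem {R : numDomainType} (I : finType) (P : pred I)
    (f : I -> R) i :
  (forall j, P j -> 0 <= f j) -> P i -> f i <= \sum_(j | P j) f j.
Proof.
move=> f0 iP; rewrite (bigD1 i)//= lerDl sumr_ge0// => j /andP[jP _].
exact: f0.
Qed.

Lemma ler_sum2_elem {R : numDomainType} (I J : finType) (P : pred I)
    (Q : pred J) (f : I -> J -> R) i j :
  (forall k l, P k -> Q l -> 0 <= f k l) -> P i -> Q j ->
  f i j <= \sum_(k | P k) \sum_(l | Q l) f k l.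
Proof.
move=> f0 iP jQ; apply: (@le_trans _ _ (\sum_(l | Q l) f i l)).
  by apply: (ler_sum_elem (f := f i)) => // l lQ; exact: f0.
apply: (ler_sum_elem (f := fun k => \sum_(l | Q l) f k l)) => // k kP.
by rewrite sumr_ge0// => l; exact: f0.
Qed.

Section Equilibrium.
Context {R : realType} {node link : finType}.
Variable G : network R node link.
Local Notation flow := (flow R node link).
Local Notation nonneg := [set z : R | 0 <= z].
Implicit Types (x y e : flow) (rho d : node -> R) (psi dpsi : node -> R -> R).

Hypothesis time_continuous :
  forall a, {within `[0, +oo[, continuous (travel_time G a)}.
Hypothesis time_increasing :
  forall a u v, 0 <= u -> u < v -> travel_time G a u < travel_time G a v.
Hypothesis beta1_gt0 : 0 < beta1 G.
Hypothesis beta2_gt0 : 0 < beta2 G.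

Definition reloc_pos x : Prop :=
  {in drivers G & riders G, forall r s, 0 < reloc x (r, s)}.

Definition variational rho x : Prop :=
  forall y, flow_feasible G y -> 0 <= marginal G rho x (y - x).

Definition subgradient psi dpsi : Prop :=
  {in riders G, forall s v w, 0 <= v -> 0 <= w ->
     dpsi s v * (w - v) <= psi s w - psi s v}.

Definition minimizer psi x : Prop :=
  flow_feasible G x /\
  forall y, flow_feasible G y -> potential G psi x <= potential G psi y.

Local Notation price dpsi x := (fun s => - dpsi s (arrivals G x s)).

Lemma variational_minimizer psi dpsi x : subgradient psi dpsi ->
  flow_feasible G x -> reloc_pos x -> variational (price dpsi x) x ->
  minimizer psi x.
Proof.
move=> hpsi xF xpos xV; split=> // y yF; rewrite -subr_ge0.
apply: le_trans (xV y yF) _; apply: potential_subgradient => //.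
- by case: xF.
- by case: yF.
- by move=> r s rD sR; left; exact: xpos.
Qed.

(** The subgradient is taken at the interior point and directed back to [x]: it is at most the
    difference of potentials, which is nonpositive at a minimizer, and [x - z] is a negative
    multiple of [y - x]. Positivity is asked of the interior point, not of [x], so the lemma can
    serve to prove that [x] is positive. *)
Lemma minimizer_segment psi dpsi x y t : subgradient psi dpsi ->
  minimizer psi x -> flow_feasible G y -> 0 < t <= 1 ->
  reloc_pos (x + t *: (y - x)) ->
  0 <= marginal G (price dpsi (x + t *: (y - x))) (x + t *: (y - x)) (y - x).
Proof.
move=> hpsi [xF xmin] yF /andP[t0 t1].
have zF : flow_feasible G (x + t *: (y - x)).
  by apply: flow_feasible_segment => //; rewrite ltW.
move Ez : (x + t *: (y - x)) zF => z zF zpos.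
have h : marginal G (price dpsi z) z (x - z) <= potential G psi x - potential G psi z.
  apply: potential_subgradient => //; [by case: zF|by case: xF|].
  by move=> r s rD sR; left; exact: zpos.
have {h} : marginal G (price dpsi z) z (x - z) <= 0.
  by apply: le_trans h _; rewrite subr_le0 xmin.
have -> : x - z = - t *: (y - x) by rewrite -Ez opprD addNKr scaleNr.
rewrite (scalar_scale _ _ (@marginal_scalar _ _ _ _ _ _)).
by rewrite mulNr oppr_le0 pmulr_rge0.
Qed.

Lemma cvg_line {T : Type} {F : set_system T} {FF : Filter F} (tau : T -> R)
    (f : flow -> R) x e : scalar f -> tau @ F --> (0 : R) ->
  f (x + tau t *: e) @[t --> F] --> f x.
Proof.
move=> lf tau0.
have -> : (fun t => f (x + tau t *: e)) = (fun t => f x + tau t * f e).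
  by apply/funext => t; rewrite scalar_line.
have := cvgD (cvg_cst (f x)) (cvgM tau0 (cvg_cst (f e))).
by rewrite mul0r addr0; apply.
Qed.

(** Coordinates at which [ln] may be discontinuous are those that [e] does not move, so their
    logarithm is constant along the line. The filter is a parameter because the limit is taken both
    at the end of a segment of flows and in a single nonnegative coordinate. *)
Lemma marginal_cvg {T : Type} {F : set_system T} {FF : Filter F}
    (tau : T -> R) dpsi x e e' :
  {in riders G, forall s, {within nonneg, continuous (dpsi s)}} ->
  flow_nonneg G x -> (\forall t \near F, flow_nonneg G (x + tau t *: e)) ->
  {in drivers G & riders G, forall r s,
     0 < reloc x (r, s) \/ reloc e (r, s) = 0} ->
  tau @ F --> (0 : R) ->
  marginal G (price dpsi (x + tau t *: e)) (x + tau t *: e) e' @[t --> F]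
    --> marginal G (price dpsi x) x e'.
Proof.
move=> cpsi x0 xt0 xe tau0; apply: cvgD.
  apply: cvg_big => [|a _]; first exact: add_continuous.
  apply: cvgM; last exact: cvg_cst.
  apply: cvgM; first exact: cvg_cst.
  apply: cvg_comp_nonneg; first exact: within_itv_nonneg.
  - exact: link_flow_ge0.
  - by apply: filterS xt0 => t; exact: link_flow_ge0.
  - exact: cvg_line (link_flow_scalar _ _) tau0.
apply: cvg_big => [|r rD]; first exact: add_continuous.
apply: cvg_big => [|s sR]; first exact: add_continuous.
apply: cvgM; last exact: cvg_cst.
apply: cvgB.
  apply: cvgM; first exact: cvg_cst.
  apply: cvgB; last exact: cvg_cst.
  have [q0|e0] := xe r s rD sR.
    apply: (@cvg_comp _ _ _ (fun t => reloc (x + tau t *: e) (r, s))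
              (@ln R) F (nbhs (reloc x (r, s)))); last exact: continuous_ln.
    exact: cvg_line (reloc_scalar (r, s)) tau0.
  under eq_cvg do rewrite /= e0 mulr0 addr0.
  exact: cvg_cst.
apply: cvgN; apply: cvg_comp_nonneg; first exact: cpsi.
- exact: arrivals_ge0.
- by apply: filterS xt0 => t; exact: arrivals_ge0.
- exact: cvg_line (arrivals_scalar _ _) tau0.
Qed.

(** The inequality of [minimizer_segment] passes to the limit as [t] tends to 0 from the right;
    positivity of [x] makes the logarithms continuous there. *)
Lemma minimizer_variational psi dpsi x : subgradient psi dpsi ->
  {in riders G, forall s, {within nonneg, continuous (dpsi s)}} ->
  minimizer psi x -> reloc_pos x -> variational (price dpsi x) x.
Proof.
move=> hpsi cpsi xmin xpos y yF; have [xF _] := xmin.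
have t01 : \forall t \near (0 : R)^'+, 0 < t < 1.
  near=> t; apply/andP; split; near: t; first exact: nbhs_right_gt.
  by apply: nbhs_right_lt.
have tau0 : t @[t --> (0 : R)^'+] --> (0 : R).
  by apply: cvg_at_right_filter; exact: cvg_id.
have seg (t : R) : 0 < t < 1 -> 0 <= t <= 1 by move=> /andP[/ltW -> /ltW ->].
apply: (@closed_cvg _ _ ((0 : R)^'+) _
  (fun t => marginal G (price dpsi (x + t *: (y - x))) (x + t *: (y - x)) (y - x))
  nonneg).
- exact: closed_ge.
- apply: filterS t01 => t t01; apply: (minimizer_segment hpsi xmin yF).
    by case/andP: t01 => -> /ltW.
  move=> r s rD sR; case: yF => -[_ _ /(_ r s rD sR) y0] _ _ _.
  have q0 := xpos r s rD sR; case/andP: t01 => t0 t1.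
  have -> : reloc (x + t *: (y - x)) (r, s)
      = (1 - t) * reloc x (r, s) + t * reloc y (r, s).
    rewrite (_ : reloc _ _ = reloc x (r, s) + t * (reloc y (r, s) - reloc x (r, s)))//.
    by ring.
  by rewrite ltr_wpDr ?mulr_gt0 ?mulr_ge0 ?subr_gt0 ?(ltW t0).
- apply: marginal_cvg => //; first by case: xF.
    apply: filterS t01 => t /seg t01; apply: flow_nonneg_segment => //.
      by case: xF.
    by case: yF.
  by move=> r s rD sR; left; exact: xpos.
Unshelve. all: end_near. Qed.

Lemma homo_mono (h : R -> R) v w :
  (forall v w, 0 <= v -> v <= w -> h v <= h w) -> 0 <= v -> 0 <= w ->
  h v * (w - v) <= h w * (w - v).
Proof.
move=> hh v0 w0; have [vw|/ltW wv] := leP v w.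
  by rewrite ler_wpM2r ?subr_ge0// hh.
by rewrite ler_wnM2r ?subr_le0// hh.
Qed.

Lemma subgradient_monotone psi dpsi s v w : subgradient psi dpsi ->
  s \in riders G -> 0 <= v -> 0 <= w -> dpsi s v * (w - v) <= dpsi s w * (w - v).
Proof.
move=> hpsi sR v0 w0; have := hpsi s sR v w v0 w0; have := hpsi s sR w v w0 v0.
by lra.
Qed.

(* The marginal cost of moving along the segment from [x] to the interior flow
   [y] is at most its value at [y], except that the slope of [z * ln z] adds a
   multiple of [ln t] at parameter [t] if [reloc x] vanishes somewhere; this is
   too negative for a minimizer [x] when [t] tends to [0]. *)
Lemma minimizer_reloc_pos psi dpsi x y : subgradient psi dpsi ->
  minimizer psi x -> flow_feasible G y -> reloc_pos y -> reloc_pos x.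
Proof.
move=> hpsi xmin yF ypos r0 s0 r0D s0R; have [xF _] := xmin.
have [[x0 y0] [_ _ x3]] : (flow_nonneg G x /\ flow_nonneg G y) /\ flow_nonneg G x.
  by case: xF yF => ? _ _ _ [].
rewrite lt_neqAle x3// andbT; apply/eqP => q0.
pose z t := x + t *: (y - x).
have zpos t : 0 < t <= 1 -> reloc_pos (z t).
  move=> /andP[t0 t1] r s rD sR.
  rewrite (_ : reloc _ _ = reloc x (r, s) + t * (reloc y (r, s) - reloc x (r, s)))//.
  have q3 := x3 r s rD sR; have q4 := ypos r s rD sR.
  rewrite (_ : _ + _ = (1 - t) * reloc x (r, s) + t * reloc y (r, s)); last by ring.
  by rewrite ltr_wpDl ?mulr_gt0 ?mulr_ge0 ?subr_ge0.
have segE (f : flow -> R) t : scalar f -> f y - f (z t) = (1 - t) * f (y - x).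
  by move=> lf; rewrite /z (scalar_line _ _ _ lf) (scalarB _ _ lf); ring.
(* Since [f y - f (z t)] is [(1 - t) * f (y - x)], monotonicity of [h] compares the slope terms at
   [z t] and at [y] in the common direction [y - x]. *)
have mono (h : R -> R) (f : flow -> R) t : 0 < t < 1 -> scalar f ->
    h (f (z t)) * (f y - f (z t)) <= h (f y) * (f y - f (z t)) ->
    h (f (z t)) * f (y - x) <= h (f y) * f (y - x).
  move=> /andP[_ t1] lf; rewrite segE// !(mulrCA (h _)).
  by rewrite ler_pM2l// subr_gt0.
pose K := marginal G (price dpsi y) y (y - x).
have bound t : 0 < t < 1 -> 0 <= K + (beta2 G)^-1 * (reloc y (r0, s0) * ln t).
  move=> t01; have [t0 t1] := andP t01.
  have z0 : flow_nonneg G (z t).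
    by apply: flow_nonneg_segment => //; rewrite (ltW t0) (ltW t1).
  have t01' : 0 < t <= 1 by rewrite t0 ltW.
  apply: le_trans (minimizer_segment hpsi xmin yF t01' (zpos _ t01')) _.
  rewrite -/(z t) /K !marginalE -!addrA; apply: lerD.
    rewrite ler_pM2l ?divr_gt0//; apply: ler_sum => a _.
    apply: (mono (travel_time G a) (fun e => link_flow G e a)) => //.
      exact: link_flow_scalar.
    apply: (homo_mono (@time_homo _ _ _ _ time_increasing a)); exact: link_flow_ge0.
  rewrite [leRHS]addrCA [leLHS]addrC -mulrDr; apply: lerD.
    apply: ler_sum => s sR; rewrite !opprK.
    apply: (mono (dpsi s) (fun e => arrivals G e s)) => //.
      exact: arrivals_scalar.
    by apply: (subgradient_monotone hpsi sR); exact: arrivals_ge0.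
  rewrite ler_pM2l ?invr_gt0// -lerBlDl -sumrB.
  under eq_bigr do rewrite -sumrB.
  (* After negation every summand is nonnegative because [ln] is increasing, so the sum dominates
     its term at [(r0, s0)]. As [x] vanishes there, [reloc (z t)] is [t * reloc y] and this term is
     exactly [- reloc y (r0, s0) * ln t]. *)
  rewrite -lerN2 -sumrN; under [leRHS]eq_bigr do rewrite -sumrN.
  have qz : reloc (z t) (r0, s0) = t * reloc y (r0, s0).
    rewrite (_ : reloc _ _ = reloc x (r0, s0)
      + t * (reloc y (r0, s0) - reloc x (r0, s0)))// -q0; ring.
  apply: le_trans (ler_sum2_elem (i := r0) (j := s0) _ r0D s0R) => [|r s rD sR].
    rewrite (_ : reloc (y - x) (r0, s0) = reloc y (r0, s0) - reloc x (r0, s0))//.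
    rewrite -q0 subr0 qz lnM ?posrE ?ypos//; lra.
  rewrite oppr_ge0 subr_le0.
  apply: (mono (fun u => ln u - beta0 G s) (fun e => reloc e (r, s))) => //.
  have zq := zpos _ t01' r s rD sR; have yq := ypos r s rD sR.
  have [le|/ltW le] := leP (reloc (z t) (r, s)) (reloc y (r, s)).
    by rewrite ler_wpM2r ?subr_ge0// lerD2r ler_ln.
  by rewrite ler_wnM2r ?subr_le0// lerD2r ler_ln.
have y3 := ypos r0 s0 r0D s0R.
have K0 : 0 <= `|K| by [].
(* At [t = expR u] the logarithmic term of [bound] equals [- (1 + |K|)], which makes the right-hand
   side negative; [u < 0] ensures that [t] lies between 0 and 1. *)
pose u := - (1 + `|K|) * beta2 G / reloc y (r0, s0).
have u0 : u < 0.
  by rewrite pmulr_llt0 ?invr_gt0// pmulr_llt0// oppr_lt0; lra.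
have := bound (expR u); rewrite expR_gt0 expR_lt1 u0 expRK.
have -> : (beta2 G)^-1 * (reloc y (r0, s0) * u) = - (1 + `|K|).
  by rewrite /u; field; rewrite !gt_eqF.
by have := ler_norm K => KK /(_ isT); lra.
Qed.

(** One unit is put on a link for each step of a path, and the O-D vectors of consecutive steps
    telescope. A link used several times carries its multiplicity. *)
Lemma path_flow i j : reachable G i j -> exists2 f : link -> R,
  forall a, 0 <= f a & forall k, \sum_a incidence G k a * f a = od R i j k.
Proof.
move=> /connectP[p + ->]; elim: p i => [|m p IHp] i /=.
  by exists (fun=> 0) => // k; rewrite /od subrr big1// => a _; rewrite mulr0.
move=> /andP[/existsP[a /andP[/eqP ai /eqP am]] /IHp[f f0 fE]].
exists (fun b => (b == a)%:R + f b) => [b|k]; first by rewrite addr_ge0.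
under eq_bigr do rewrite mulrDr.
rewrite big_split/= fE (bigD1 a)//= eqxx mulr1 big1 => [|b /negPf->]; last first.
  by rewrite mulr0.
by rewrite /incidence ai am /od; ring.
Qed.

(** Each driver node divides its supply equally among the rider nodes, which makes every relocation
    flow positive; unit path flows, scaled, route these flows and the trips to the destinations. *)
Lemma exists_positive_flow :
  riders G != finset.set0 ->
  {in drivers G & riders G, forall r s, reachable G r s} ->
  {in riders G & dests G, forall s k, reachable G s k} ->
  {in drivers G, forall r, 0 < driver_supply G r} ->
  {in riders G, forall s, 0 <= departures G s} ->
  {in riders G & dests G, forall s k, 0 <= fraction G s k} ->
  exists2 x, flow_feasible G x & reloc_pos x.
Proof.
move=> R0 reachS reachK Q0 D0 f0.
have /boolp.choice[P PE] (p : node * node) : exists f : link -> R,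
    reachable G p.1 p.2 -> (forall a, 0 <= f a) /\
    forall k, \sum_a incidence G k a * f a = od R p.1 p.2 k.
  have [/path_flow[f ? ?]|] := boolP (reachable G p.1 p.2); first by exists f.
  by exists (fun=> 0).
have n0 : 0 < (#|riders G|%:R : R) by rewrite ltr0n card_gt0.
pose q r := driver_supply G r / #|riders G|%:R.
have q0 r : r \in drivers G -> 0 < q r by move=> rD; rewrite divr_gt0// Q0.
exists (Flow (fun p => q p.1.1 * P p.1 p.2)
             (fun p => trips G p.1.1 p.1.2 * P p.1 p.2) (fun p => q p.1)).
  split.
  - split=> [r s rD sR a|s k sR kK a|r s rD sR] /=.
    + by rewrite mulr_ge0 ?(ltW (q0 _ _))//; apply: (PE (r, s) _).1; exact: reachS.
    + rewrite mulr_ge0//; last by apply: (PE (s, k) _).1; exact: reachK.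
      by rewrite mulr_ge0// ?f0// D0.
    + exact/ltW/q0.
  - move=> r s rD sR i; rewrite /vhat_residual/=.
    under eq_bigr do rewrite mulrCA.
    by rewrite -mulr_sumr (PE (r, s) _).2 ?subrr//; exact: reachS.
  - move=> s k sR kK i; rewrite /vcheck_residual/=.
    under eq_bigr do rewrite mulrCA.
    by rewrite -mulr_sumr (PE (s, k) _).2 ?subrr//; exact: reachK.
  - move=> r rD; rewrite /supply_residual/= sumr_const -mulr_natr.
    by rewrite divfK ?subrr// gt_eqF.
by move=> r s rD sR; exact: q0.
Qed.

End Equilibrium.

(** * Existence of a minimizer *)

Lemma scalar_big {R : pzRingType} {V : lmodType R} (f : V -> R) (I : finType)
    (c : I -> R) (v : I -> V) :
  scalar f -> f (\sum_i c i *: v i) = \sum_i c i * f (v i).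
Proof.
move=> lf; elim/big_rec2: _ => [|i x y _ <-]; last by rewrite lf.
by rewrite -(subrr 0) scalarB// subrr.
Qed.

Lemma closed_eq0 {R : realType} {T : topologicalType} {I : Type}
    (P : I -> Prop) (g : I -> T -> R) :
  (forall i, continuous (g i)) -> closed [set u | forall i, P i -> g i u = 0].
Proof.
move=> cg; apply: (@closed_bigI _ _ P (fun i => [set u | g i u = 0])) => i _.
have /continuous_closedP h := cg i.
by apply: (h [set 0]); apply: accessible_closed_set1; apply: hausdorff_accessible; exact: norm_hausdorff.
Qed.

Section Existence.
Context {R : realType} {node link : finType}.
Variable G : network R node link.
Local Notation flow := (flow R node link).
Local Notation nonneg := [set z : R | 0 <= z].
Implicit Types (x y e : flow).

(** Coordinates outside the drivers, riders and destinations are unconstrained, so a set of feasible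
    flows is not bounded as it stands; a flow may be altered there without affecting feasibility or
    potential. *)
Definition eq_flow x y : Prop :=
  [/\ {in drivers G & riders G, forall r s a, vhat x (r, s, a) = vhat y (r, s, a)},
      {in riders G & dests G, forall s k a, vcheck x (s, k, a) = vcheck y (s, k, a)} &
      {in drivers G & riders G, forall r s, reloc x (r, s) = reloc y (r, s)}].

Lemma eq_link_flow x y a : eq_flow x y -> link_flow G x a = link_flow G y a.
Proof.
move=> [e1 e2 _]; congr (_ + _); apply: eq_bigr => i iP; apply: eq_bigr => j jP.
  exact: e1.
exact: e2.
Qed.

Lemma eq_potential psi x y : eq_flow x y -> potential G psi x = potential G psi y.
Proof.
move=> exy; have [_ _ e3] := exy; congr (_ * _ + _ * _ + _).
- by apply: eq_bigr => a _; rewrite (eq_link_flow _ exy).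
- by apply: eq_bigr => r rD; apply: eq_bigr => s sR; rewrite e3.
- apply: eq_bigr => s sR; congr (psi s _); apply: eq_bigr => r rD; exact: e3.
Qed.

Lemma eq_flow_feasible x y : eq_flow x y -> flow_feasible G x -> flow_feasible G y.
Proof.
move=> [e1 e2 e3] [[n1 n2 n3] f1 f2 f3]; split; first split.
- by move=> r s rD sR a; rewrite -e1// n1.
- by move=> s k sR kK a; rewrite -e2// n2.
- by move=> r s rD sR; rewrite -e3// n3.
- move=> r s rD sR i; rewrite -(f1 r s rD sR i) /vhat_residual e3//.
  by congr (_ - _); apply: eq_bigr => a _; rewrite e1.
- move=> s k sR kK i; rewrite -(f2 s k sR kK i) /vcheck_residual.
  by congr (_ - _); apply: eq_bigr => a _; rewrite e2.
- move=> r rD; rewrite -(f3 r rD) /supply_residual.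
  by congr (_ - _); apply: eq_bigr => s sR; rewrite e3.
Qed.

Local Notation coordinate := ((node * node * link + node * node * link)
  + node * node)%type.

(** All coordinates are listed in one row vector, for which compactness of boxes and the extreme
    value theorem are available. *)
Definition flow_of (u : 'rV[R]_#|{: coordinate}|) : flow :=
  Flow (fun p => u ord0 (enum_rank (inl (inl p) : coordinate)))
       (fun p => u ord0 (enum_rank (inl (inr p) : coordinate)))
       (fun p => u ord0 (enum_rank (inr p : coordinate))).

Definition row_of x : 'rV[R]_#|{: coordinate}| := \row_j match enum_val j with
  | inl (inl p) => vhat x p | inl (inr p) => vcheck x p | inr p => reloc x p end.

Lemma row_ofK : cancel row_of flow_of.
Proof. by move=> x; apply: flowP => p /=; rewrite mxE enum_rankK. Qed.

Lemma flow_of_continuous (f : flow -> R) : scalar f ->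
  continuous (fun u => f (flow_of u)).
Proof.
move=> lf.
have lfo : scalar (fun u => f (flow_of u)).
  move=> c u v; rewrite -lf; congr f.
  by apply: flowP => p /=; rewrite !mxE.
have fE u : f (flow_of u) = \sum_j u ord0 j * f (flow_of (delta_mx ord0 j)).
  rewrite {1}(row_sum_delta u).
  exact: (scalar_big (f := fun u => f (flow_of u)) _ _ lfo).
have -> : (fun u => f (flow_of u))
    = (fun u => \sum_j u ord0 j * f (flow_of (delta_mx ord0 j))).
  by apply/funext => u; exact: fE.
move=> u; apply: (cvg_big _ (F := nbhs u)) => [|j _]; first exact: add_continuous.
by apply: cvgM; [exact: coord_continuous|exact: cvg_cst].
Qed.

Hypothesis time_ge0 : forall a u, 0 <= u -> 0 <= travel_time G a u.
Hypothesis time_continuous :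
  forall a, {within `[0, +oo[, continuous (travel_time G a)}.
Hypothesis time_increasing :
  forall a u v, 0 <= u -> u < v -> travel_time G a u < travel_time G a v.
Hypothesis supply_gt0 : {in drivers G, forall r, 0 < driver_supply G r}.
Hypothesis beta1_gt0 : 0 < beta1 G.
Hypothesis beta2_gt0 : 0 < beta2 G.
Hypothesis slope_gt0 : {in riders G, forall s, 0 < slope G s}.

Definition quad s (v : R) : R := (slope G s)^-1 * (v ^+ 2 / 2 - demand0 G s * v).
Definition dquad s (v : R) : R := (slope G s)^-1 * (v - demand0 G s).

Lemma quad_subgradient : subgradient G quad dquad.
Proof.
move=> s sR v w v0 w0; rewrite /quad /dquad -mulrBr -mulrA ler_pM2l; last first.
  by rewrite invr_gt0 slope_gt0.
by have := sqr_ge0 (w - v); rewrite !expr2; lra.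
Qed.

Lemma dquad_continuous s : {within nonneg, continuous (dquad s)}.
Proof.
apply: continuous_subspaceT => v; apply: cvgM; first exact: cvg_cst.
by apply: cvgB; [exact: cvg_id|exact: cvg_cst].
Qed.

Definition time_integral a v : R :=
  \int[lebesgue_measure]_(u in `[0, v]) travel_time G a u.

Lemma time_integral_subgradient a v w : 0 <= v -> 0 <= w ->
  travel_time G a v * (w - v) <= time_integral a w - time_integral a v.
Proof. by apply: Rintegral_subgradient => //; exact: time_homo. Qed.

Lemma potential_continuous (F : set_system 'rV[R]_#|{: coordinate}|) (FF : Filter F) u :
  flow_nonneg G (flow_of u) -> (\forall v \near F, flow_nonneg G (flow_of v)) ->
  F --> u -> potential G quad (flow_of v) @[v --> F] --> potential G quad (flow_of u).
Proof.
move=> u0 F0 Fu.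
have lin (f : flow -> R) : scalar f -> f (flow_of v) @[v --> F] --> f (flow_of u).
  by move=> /flow_of_continuous /(_ u) h; apply: cvg_trans h; exact: cvg_app.
apply: cvgD; first apply: cvgD.
- apply: cvgM; first exact: cvg_cst.
  apply: cvg_big => [|a _]; first exact: add_continuous.
  apply: (cvg_comp_nonneg (h := time_integral a)).
  + apply: (@continuous_of_subgradient _ _ (travel_time G a)).
      exact: time_integral_subgradient.
    exact: within_itv_nonneg.
  + exact: link_flow_ge0.
  + by apply: filterS F0 => v; exact: link_flow_ge0.
  + exact: lin (link_flow_scalar _ _).
- apply: cvgM; first exact: cvg_cst.
  apply: cvg_big => [|r rD]; first exact: add_continuous.
  apply: cvg_big => [|s sR]; first exact: add_continuous.
  have rl := lin _ (reloc_scalar (r, s)).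
  have xl : (reloc (flow_of v) (r, s) * ln (reloc (flow_of v) (r, s)))
      @[v --> F] --> reloc (flow_of u) (r, s) * ln (reloc (flow_of u) (r, s)).
    apply: (cvg_comp_nonneg (h := fun z : R => z * ln z)) => //.
    - exact: xlnx_continuous.
    - by case: u0 => _ _; apply.
    - by apply: filterS F0 => v [_ _]; apply.
  (* At 0 only the product [q * ln q] is continuous, not [ln q], so it is separated from the terms
     linear in [q]. *)
  have -> : (fun v => reloc (flow_of v) (r, s)
      * (ln (reloc (flow_of v) (r, s)) - 1 - beta0 G s))
    = (fun v => reloc (flow_of v) (r, s) * ln (reloc (flow_of v) (r, s))
        - reloc (flow_of v) (r, s) * (1 + beta0 G s)).
    by apply/funext => v; ring.
  have -> (q : R) : q * (ln q - 1 - beta0 G s) = q * ln q - q * (1 + beta0 G s).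
    by ring.
  by apply: cvgB => //; apply: cvgM => //; exact: cvg_cst.
- apply: cvg_big => [|s sR]; first exact: add_continuous.
  have al := lin _ (arrivals_scalar G s).
  apply: cvgM; first exact: cvg_cst.
  apply: cvgB; last by apply: cvgM => //; exact: cvg_cst.
  by apply: cvgM; [rewrite expr2; apply: cvgM|exact: cvg_cst].
Qed.

(** The supporting line is taken at 1 because its slope is positive by strict monotonicity, whereas
    the travel time at 0 may be 0. *)
Lemma time_integral_ge a v : 0 <= v ->
  travel_time G a 1 * (v - 1) <= time_integral a v.
Proof.
move=> v0; apply: le_trans (time_integral_subgradient _ ler01 v0) _.
by rewrite gerBl Rintegral_ge0// => u /=; rewrite in_itv/= => /andP[/time_ge0].
Qed.

(** [K] compensates the minima of the other terms: [q * (ln q - 1 - beta0 G s)] is least at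
    [q = expR (beta0 G s)], with value [- expR (beta0 G s)], and the quadratic term is least at
    [demand0 G s]. What remains bounds the flow on each link. *)
Lemma potential_coercive : exists K, forall x a, flow_nonneg G x ->
  beta1 G / beta2 G * (travel_time G a 1 * (link_flow G x a - 1))
  <= potential G quad x + K.
Proof.
exists ((beta2 G)^-1 * (\sum_(r in drivers G) \sum_(s in riders G) expR (beta0 G s))
  + \sum_(s in riders G) (slope G s)^-1 * (demand0 G s ^+ 2 / 2)).
move=> x a x0; rewrite /potential addrACA -[X in _ <= X + _]addrA -[leRHS]addrA.
rewrite -[leLHS]addr0; apply: lerD.
  rewrite ler_pM2l ?divr_gt0//; apply: (@le_trans _ _ (time_integral a (link_flow G x a))).
    by apply: time_integral_ge; exact: link_flow_ge0.
  apply: (ler_sum_elem (P := xpredT)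
    (f := fun a => time_integral a (link_flow G x a))) => // b _.
  by rewrite Rintegral_ge0// => u /=; rewrite in_itv/= => /andP[/time_ge0].
rewrite addr_ge0//.
  rewrite -mulrDr mulr_ge0//; first by rewrite invr_ge0 ltW.
  rewrite -big_split/=.
  apply: sumr_ge0 => r rD; rewrite -big_split; apply: sumr_ge0 => s sR /=.
  have q0 : 0 <= reloc x (r, s) by case: x0 => _ _; apply.
  by have := xlnx_subgradient (expR_gt0 (beta0 G s)) q0; rewrite expRK; lra.
rewrite -big_split; apply: sumr_ge0 => s sR /=.
rewrite /quad -mulrDr mulr_ge0//; first by rewrite invr_ge0 ltW// slope_gt0.
by have := sqr_ge0 (arrivals G x s - demand0 G s); rewrite !expr2; lra.
Qed.

Definition bounded_flow (M : R) x : Prop :=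
  [/\ {in drivers G & riders G, forall r s a, vhat x (r, s, a) <= M},
      {in riders G & dests G, forall s k a, vcheck x (s, k, a) <= M} &
      {in drivers G & riders G, forall r s, reloc x (r, s) <= M}].

Lemma sublevel_bounded B : exists2 M, 0 <= M & forall x, flow_feasible G x ->
  potential G quad x <= B -> bounded_flow M x.
Proof.
have [K KP] := potential_coercive.
have t1 a : 0 < travel_time G a 1.
  by apply: le_lt_trans (time_ge0 a (lexx 0)) _; exact: time_increasing.
(* [C a] comes from solving the coercivity inequality at level [B] for the flow on [a]; the absolute
   value keeps it nonnegative, so that the sum over the links bounds each of them. Individual link
   flows are nonnegative summands of the total, and relocation flows are bounded by the supply. *)
pose C a := 1 + `|B + K| / (beta1 G / beta2 G * travel_time G a 1).
have C0 a : 0 <= C a by rewrite addr_ge0// divr_ge0// ltW// mulr_gt0// divr_gt0.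
have S0 : 0 <= \sum_(r in drivers G) driver_supply G r.
  by apply: sumr_ge0 => r rD; rewrite ltW// supply_gt0.
have SC0 : 0 <= \sum_a C a by exact: sumr_ge0.
exists (\sum_a C a + \sum_(r in drivers G) driver_supply G r); first exact: addr_ge0.
move=> x xF xB; have [x0 _ _ xS] := xF; have [x1 x2 x3] := x0.
have link_le a : link_flow G x a <= \sum_a C a + \sum_(r in drivers G) driver_supply G r.
  apply: ler_wpDr => //.
  apply: le_trans (ler_sum_elem (P := xpredT) (i := a) (fun b _ => C0 b) _) => //.
  have c0 : 0 < beta1 G / beta2 G * travel_time G a 1.
    by apply: mulr_gt0 => //; exact: divr_gt0.
  rewrite /C -lerBlDl ler_pdivlMr//.
  have := KP x a x0; have := ler_norm (B + K); lra.
split.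
- move=> r s rD sR a; apply: le_trans (link_le a); rewrite /link_flow.
  apply: ler_wpDr.
    by apply: sumr_ge0 => i iP; apply: sumr_ge0 => j jP; exact: x2.
  apply: (ler_sum2_elem (f := fun r s => vhat x (r, s, a))) => // k l kD lR.
  exact: x1.
- move=> s k sR kK a; apply: le_trans (link_le a); rewrite /link_flow.
  apply: ler_wpDl.
    by apply: sumr_ge0 => i iP; apply: sumr_ge0 => j jP; exact: x1.
  apply: (ler_sum2_elem (f := fun s k => vcheck x (s, k, a))) => // i l iR lK.
  exact: x2.
- move=> r s rD sR; apply: ler_wpDl => //.
  apply: (@le_trans _ _ (driver_supply G r)).
    have /eqP := xS r rD; rewrite subr_eq0 => /eqP ->.
    apply: (ler_sum_elem (f := fun s => reloc x (r, s))) => // j jR; exact: x3.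
  by apply: (ler_sum_elem (f := driver_supply G)) => // j jD; rewrite ltW// supply_gt0.
Qed.

Lemma exists_minimizer y0 : flow_feasible G y0 -> exists x, minimizer G quad x.
Proof.
move=> y0F; have [M M0 bnd] := sublevel_bounded (potential G quad y0).
(* Clipping every coordinate to [[0, M]] moves a flow into a compact box. On the sublevel set of
   [y0] it leaves the coordinates of the model unchanged, so only the unconstrained ones are
   altered. *)
pose clip (z : R) := Num.min M (Num.max 0 z).
have clipE z : 0 <= z -> z <= M -> clip z = z.
  by move=> z0 zM; rewrite /clip max_r// min_r.
have clip01 z : `[0, M]%classic (clip z).
  by rewrite /= in_itv/= ge_min lexx /= le_min M0 le_max lexx.
pose clipf y : flow := Flow (clip \o vhat y) (clip \o vcheck y) (clip \o reloc y).
have clipP y : flow_feasible G y -> potential G quad y <= potential G quad y0 ->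
    eq_flow y (clipf y).
  move=> yF yB; have [[y1 y2 y3] _ _ _] := yF; have [b1 b2 b3] := bnd y yF yB.
  split.
  - by move=> r s rD sR a; rewrite /= clipE ?y1 ?b1.
  - by move=> s k sR kK a; rewrite /= clipE ?y2 ?b2.
  - by move=> r s rD sR; rewrite /= clipE ?y3 ?b3.
pose box := [set u : 'rV[R]_#|{: coordinate}| | forall i, `[0, M]%classic (u ord0 i)].
pose E1 := [set u | forall p : node * node * node,
  p.1.1 \in drivers G /\ p.1.2 \in riders G ->
  vhat_residual G (flow_of u) p.1.1 p.1.2 p.2 = 0].
pose E2 := [set u | forall p : node * node * node,
  p.1.1 \in riders G /\ p.1.2 \in dests G ->
  vcheck_residual G (flow_of u) p.1.1 p.1.2 p.2 = 0].
pose E3 := [set u | forall r, r \in drivers G -> supply_residual G (flow_of u) r = 0].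
pose A := box `&` (E1 `&` (E2 `&` E3)).
have box_nonneg u : box u -> flow_nonneg G (flow_of u).
  move=> ub; have ub0 i : 0 <= u ord0 i.
    by have := ub i; rewrite /= in_itv/= => /andP[].
  by split=> [? ? _ _ ?|? ? _ _ ?|? ? _ _]; exact: ub0.
have AP u : A u -> flow_feasible G (flow_of u).
  move=> [ub [u1 [u2 u3]]]; split; first exact: box_nonneg.
  - by move=> r s rD sR i; exact: (u1 (r, s, i)).
  - by move=> s k sR kK i; exact: (u2 (s, k, i)).
  - by move=> r rD; exact: u3.
have rowA y : flow_feasible G y -> potential G quad y <= potential G quad y0 ->
    A (row_of (clipf y)).
  move=> yF yB; have [_ f1 f2 f3] := eq_flow_feasible (clipP y yF yB) yF.
  split; [|split; [|split]].
  - by move=> i; rewrite mxE; case: (enum_val i) => [[p|p]|p]; exact: clip01.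
  - by move=> [[r s] i] [rD sR]; rewrite row_ofK; exact: f1.
  - by move=> [[s k] i] [sR kK]; rewrite row_ofK; exact: f2.
  - by move=> r rD; rewrite row_ofK; exact: f3.
have cA : compact A.
  apply: compact_closedI.
    exact: (rV_compact (fun=> @segment_compact R 0 M)).
  apply: closedI; last apply: closedI.
  - apply: (closed_eq0 (g := fun p u => vhat_residual G (flow_of u) p.1.1 p.1.2 p.2)).
    move=> p.
    exact: (flow_of_continuous (@vhat_residual_scalar _ _ _ G p.1.1 p.1.2 p.2)).
  - apply: (closed_eq0 (g := fun p u => vcheck_residual G (flow_of u) p.1.1 p.1.2 p.2)).
    move=> p u; have /flow_of_continuous/(_ u) h :=
      @vcheck_net_scalar _ _ _ G p.1.1 p.1.2 p.2.
    exact: (cvgB (cvg_cst _) h).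
  - apply: (closed_eq0 (g := fun r u => supply_residual G (flow_of u) r)).
    move=> r u; have /flow_of_continuous/(_ u) h := @sent_scalar _ _ _ G r.
    exact: (cvgB (cvg_cst _) h).
have [||c cA' cmin] := @EVT_min_rV R _ (potential G quad \o flow_of) A _ cA.
- by exists (row_of (clipf y0)); exact: rowA.
- apply/subspace_continuousP => u uA; apply: potential_continuous.
  + by case: (AP u uA).
  + suff : nbhs u [set v | A v -> flow_nonneg G (flow_of v)] by [].
    by apply: filterE => v /AP[].
  + exact: cvg_within.
exists (flow_of c); split; first by apply: AP; rewrite inE in cA'.
(* Flows in the sublevel set of [y0] have a representative in [A]; all others are compared through
   [y0] itself. *)
have main y : flow_feasible G y -> potential G quad y <= potential G quad y0 ->
    potential G quad (flow_of c) <= potential G quad y.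
  move=> yF yB; rewrite (eq_potential _ (clipP y yF yB)).
  by have := cmin _ (mem_set (rowA y yF yB)); rewrite /= row_ofK.
move=> y yF; have [|/ltW yB] := leP (potential G quad y) (potential G quad y0).
  exact: main.
by apply: le_trans yB; exact: main.
Qed.

End Existence.

(** * Multipliers *)

Section Sums.
Context {R : pzRingType} {I J K : finType}.
Variables (P : pred I) (Q : pred J).

Lemma sum2_unit (F : I -> J -> R) i0 j0 : P i0 -> Q j0 ->
  \sum_(i | P i) \sum_(j | Q j) F i j * ((i, j) == (i0, j0))%:R = F i0 j0.
Proof.
move=> Pi0 Qj0; rewrite (bigD1 i0)//= (bigD1 j0)//= eqxx mulr1.
rewrite big1 => [|j /andP[_ /negPf jj0]]; last by rewrite xpair_eqE jj0 andbF mulr0.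
rewrite addr0 big1 ?addr0// => i /andP[_ /negPf ii0].
by rewrite big1// => j _; rewrite xpair_eqE ii0 mulr0.
Qed.

Lemma sum3_unit (F : I -> J -> K -> R) i0 j0 k0 : P i0 -> Q j0 ->
  \sum_(i | P i) \sum_(j | Q j) \sum_k F i j k * ((i, j, k) == (i0, j0, k0))%:R
  = F i0 j0 k0.
Proof.
move=> Pi0 Qj0; rewrite -(sum2_unit (fun i j => F i j k0) Pi0 Qj0).
apply: eq_bigr => i _; apply: eq_bigr => j _; rewrite (bigD1 k0)//= big1 ?addr0.
  by rewrite xpair_eqE eqxx andbT.
by move=> k /negPf kk0; rewrite xpair_eqE kk0 andbF mulr0.
Qed.

Lemma sum3_pair (F : I -> J -> K -> R) :
  \sum_(i | P i) \sum_(j | Q j) \sum_k F i j k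
  = \sum_(p : I * J * K | P p.1.1 && Q p.1.2) F p.1.1 p.1.2 p.2.
Proof.
rewrite pair_big/= pair_big/=; apply: eq_bigl => p; exact: andbT.
Qed.

End Sums.

Section Multipliers.
Context {R : realType} {node link : finType}.
Variable G : network R node link.
Local Notation flow := (flow R node link).
Local Notation multipliers := (multipliers R node).
Implicit Types (x y e : flow) (l : multipliers) (rho d : node -> R).

Definition residual_term l x : R :=
  \sum_(r in drivers G) \sum_(s in riders G) \sum_i
      mult_vhat l r s i * vhat_residual G x r s i
  + \sum_(s in riders G) \sum_(k in dests G) \sum_i
      mult_vcheck l s k i * vcheck_residual G x s k i
  + \sum_(r in drivers G) mult_supply l r * supply_residual G x r.

(** The derivative of [residual_term l] in the direction [e]; it does not depend on the base point
    because the residuals are affine. *)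
Definition residual_slope l e : R :=
  \sum_(r in drivers G) \sum_(s in riders G) \sum_i
      mult_vhat l r s i * vhat_residual G e r s i
  + \sum_(s in riders G) \sum_(k in dests G) \sum_i
      mult_vcheck l s k i * - vcheck_net G e s k i
  + \sum_(r in drivers G) mult_supply l r * - sent G e r.

Lemma residual_term_line l x e c :
  residual_term l (x + c *: e) = residual_term l x + c * residual_slope l e.
Proof.
rewrite /residual_term /residual_slope !mulrDr addrACA; congr (_ + _); last first.
  rewrite mulr_sumr -big_split; apply: eq_bigr => r _ /=.
  rewrite !supply_residualE (scalar_line _ _ _ (@sent_scalar _ _ _ G r)); ring.
rewrite addrACA; congr (_ + _);
  do 2 (rewrite mulr_sumr -big_split; apply: eq_bigr => ? _ /=);
  rewrite mulr_sumr -big_split; apply: eq_bigr => i _ /=.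
  rewrite (scalar_line _ _ _ (@vhat_residual_scalar _ _ _ G _ _ i)); ring.
rewrite !vcheck_residualE (scalar_line _ _ _ (@vcheck_net_scalar _ _ _ G _ _ i)).
ring.
Qed.

Lemma residual_term0 l x : flow_feasible G x -> residual_term l x = 0.
Proof.
move=> [_ x1 x2 x3]; rewrite /residual_term big1 ?add0r => [|r rD].
  rewrite big1 ?add0r => [|s sR].
    by rewrite big1// => r rD; rewrite x3// mulr0.
  by rewrite big1// => k kK; rewrite big1// => i _; rewrite x2// mulr0.
by rewrite big1// => s sR; rewrite big1// => i _; rewrite x1// mulr0.
Qed.

Lemma residual_slope0 l x y : flow_feasible G x -> flow_feasible G y ->
  residual_slope l (y - x) = 0.
Proof.
move=> xF yF; have := residual_term_line l x (y - x) 1.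
by rewrite scale1r addrC subrK !residual_term0// mul1r add0r => <-.
Qed.

(** The price term splits into [- rho s] times the arrivals, which turns the flow part into the
    potential of the lower level at prices [rho], and [rho s * d s], which leaves a separate
    one-variable problem for each [d s]. *)
Lemma lagrangianE l rho x d : SL_lagrangian G l rho x d =
  potential G (fun s v => - rho s * v) x
  + \sum_(s in riders G) (quad G s (d s) + rho s * d s) + residual_term l x.
Proof.
rewrite /SL_lagrangian /residual_term !addrA; congr (_ + _ + _ + _).
rewrite /SL_objective /potential -[LHS]addrA -[RHS]addrA; congr (_ + _).
rewrite -!big_split; apply: eq_bigr => s _ /=.
by rewrite /demand_residual /quad /arrivals; ring.
Qed.

(** A reduced cost: the scaled travel time of [a] minus the difference of the node multipliers at
    its two ends. It is the partial derivative of the Lagrangian in this link flow. *)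
Definition vhat_coef l x (r s : node) a : R :=
  beta1 G / beta2 G * travel_time G a (link_flow G x a)
  - \sum_i mult_vhat l r s i * incidence G i a.

Definition vcheck_coef l x (s k : node) a : R :=
  beta1 G / beta2 G * travel_time G a (link_flow G x a)
  - \sum_i mult_vcheck l s k i * incidence G i a.

Definition reloc_coef l rho x (r s : node) : R :=
  (beta2 G)^-1 * (ln (reloc x (r, s)) - beta0 G s) - rho s
  + \sum_i mult_vhat l r s i * od R r s i - mult_supply l r.

(** Exchanging sums moves the incidence matrix from the flows to the multipliers, so the slope of
    the Lagrangian becomes a sum over coordinates. *)
Lemma slopeE l rho x e : marginal G rho x e + residual_slope l e =
  \sum_(r in drivers G) \sum_(s in riders G) \sum_a
      vhat_coef l x r s a * vhat e (r, s, a)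
  + \sum_(s in riders G) \sum_(k in dests G) \sum_a
      vcheck_coef l x s k a * vcheck e (s, k, a)
  + \sum_(r in drivers G) \sum_(s in riders G) reloc_coef l rho x r s * reloc e (r, s).
Proof.
have incE (m : node -> R) (v : link -> R) :
  \sum_i m i * (\sum_a incidence G i a * v a)
  = \sum_a (\sum_i m i * incidence G i a) * v a.
  under eq_bigr do rewrite mulr_sumr; rewrite exchange_big/=; apply: eq_bigr => a _.
  by rewrite mulr_suml; apply: eq_bigr => i _; rewrite mulrA.
pose T a := beta1 G / beta2 G * travel_time G a (link_flow G x a).
have -> : marginal G rho x e =
    \sum_(r in drivers G) \sum_(s in riders G) \sum_a T a * vhat e (r, s, a)
  + \sum_(s in riders G) \sum_(k in dests G) \sum_a T a * vcheck e (s, k, a)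
  + \sum_(r in drivers G) \sum_(s in riders G)
      ((beta2 G)^-1 * (ln (reloc x (r, s)) - beta0 G s) - rho s) * reloc e (r, s).
  congr (_ + _); under eq_bigr do rewrite /link_flow mulrDr; rewrite big_split/=.
  by congr (_ + _); under eq_bigr do rewrite mulr_sumr; rewrite exchange_big/=;
    apply: eq_bigr => i _; under eq_bigr do rewrite mulr_sumr; rewrite exchange_big.
have -> : residual_slope l e =
    \sum_(r in drivers G) \sum_(s in riders G) \sum_a
      - (\sum_i mult_vhat l r s i * incidence G i a) * vhat e (r, s, a)
  + \sum_(s in riders G) \sum_(k in dests G) \sum_a
      - (\sum_i mult_vcheck l s k i * incidence G i a) * vcheck e (s, k, a)
  + \sum_(r in drivers G) \sum_(s in riders G)
      (\sum_i mult_vhat l r s i * od R r s i - mult_supply l r) * reloc e (r, s).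
  rewrite /residual_slope addrAC [RHS]addrAC; congr (_ + _); last first.
    apply: eq_bigr => s _; apply: eq_bigr => k _.
    under [LHS]eq_bigr do rewrite mulrN; under [RHS]eq_bigr do rewrite mulNr.
    by rewrite !sumrN -incE.
  rewrite -!big_split; apply: eq_bigr => r _ /=.
  rewrite /sent -sumrN mulr_sumr -!big_split; apply: eq_bigr => s _ /=.
  under [in RHS]eq_bigr do rewrite mulNr.
  rewrite sumrN -incE mulrBl mulr_suml addrA -sumrN -big_split/= mulrN; congr (_ - _).
  by apply: eq_bigr => i _; rewrite /vhat_residual mulrBr; ring.
rewrite addrACA (addrACA (\sum_(r in _) _)); congr (_ + _ + _);
  rewrite -big_split; apply: eq_bigr => i _ /=; rewrite -big_split;
  apply: eq_bigr => j _ /=; try (rewrite -big_split; apply: eq_bigr => a _ /=).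
- by rewrite -mulrDl.
- by rewrite -mulrDl.
- by rewrite -mulrDl /reloc_coef !addrA.
Qed.

Definition vhat_unit p : flow := Flow (fun p' => (p' == p)%:R) (fun=> 0) (fun=> 0).
Definition vcheck_unit p : flow := Flow (fun=> 0) (fun p' => (p' == p)%:R) (fun=> 0).
Definition reloc_unit p : flow := Flow (fun=> 0) (fun=> 0) (fun p' => (p' == p)%:R).

Lemma vhat_slope l rho x r s a : r \in drivers G -> s \in riders G ->
  marginal G rho x (vhat_unit (r, s, a)) + residual_slope l (vhat_unit (r, s, a))
  = vhat_coef l x r s a.
Proof.
move=> rD sR; rewrite slopeE /= sum3_unit//.
by rewrite !big1 ?addr0// => *; rewrite !big1// => *; rewrite ?big1// => *; rewrite mulr0.
Qed.

Lemma vcheck_slope l rho x s k a : s \in riders G -> k \in dests G ->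
  marginal G rho x (vcheck_unit (s, k, a)) + residual_slope l (vcheck_unit (s, k, a))
  = vcheck_coef l x s k a.
Proof.
move=> sR kK; rewrite slopeE /= sum3_unit//.
by rewrite !big1 ?addr0 ?add0r// => *; rewrite !big1// => *; rewrite ?big1// => *; rewrite mulr0.
Qed.

Lemma reloc_slope l rho x r s : r \in drivers G -> s \in riders G ->
  marginal G rho x (reloc_unit (r, s)) + residual_slope l (reloc_unit (r, s))
  = reloc_coef l rho x r s.
Proof.
move=> rD sR; rewrite slopeE /= sum2_unit//.
by rewrite !big1 ?add0r// => *; rewrite !big1// => *; rewrite ?big1// => *; rewrite mulr0.
Qed.

End Multipliers.

(** * Partial derivatives of the Lagrangian *)

Section KKT.
Context {R : realType} {node link : finType}.
Variable G : network R node link.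
Local Notation flow := (flow R node link).
Local Notation multipliers := (multipliers R node).
Local Notation nonneg := [set z : R | 0 <= z].
Implicit Types (x y e : flow) (l : multipliers) (rho d : node -> R).

Hypothesis time_continuous :
  forall a, {within `[0, +oo[, continuous (travel_time G a)}.
Hypothesis time_increasing :
  forall a u v, 0 <= u -> u < v -> travel_time G a u < travel_time G a v.
Hypothesis beta1_gt0 : 0 < beta1 G.
Hypothesis beta2_gt0 : 0 < beta2 G.
Hypothesis slope_gt0 : {in riders G, forall s, 0 < slope G s}.

Local Notation linear_potential rho := (potential G (fun s v => - rho s * v)).

Lemma linear_subgradient rho :
  subgradient G (fun s v => - rho s * v) (fun s _ => - rho s).
Proof. by move=> s _ v w _ _; rewrite mulrBr. Qed.

Lemma linear_potential_subgradient rho x y :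
  flow_nonneg G x -> flow_nonneg G y ->
  {in drivers G & riders G, forall r s,
     0 < reloc x (r, s) \/ reloc x (r, s) = reloc y (r, s)} ->
  marginal G rho x (y - x) <= linear_potential rho y - linear_potential rho x.
Proof.
move=> x0 y0 qx.
have -> : marginal G rho = marginal G (fun s => - - rho s).
  by congr marginal; apply/funext => s; rewrite opprK.
exact: (potential_subgradient time_continuous time_increasing
  beta1_gt0 beta2_gt0 (@linear_subgradient rho) x0 y0 qx).
Qed.

(** The potential is convex and the remaining terms are affine along the line, so the subgradient
    inequalities at [x] and at the moved flow yield the derivative. A general direction [e] covers
    the three kinds of flow coordinates at once. *)
Lemma lagrangian_derivative l rho x e d (y : R) : 0 <= y ->
  (forall z, 0 <= z -> flow_nonneg G (x + (z - y) *: e)) ->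
  {in drivers G & riders G, forall r s,
     0 < reloc x (r, s) \/ reloc e (r, s) = 0} ->
  derivative_on_nonneg (fun z => SL_lagrangian G l rho (x + (z - y) *: e) d) y
    (marginal G rho x e + residual_slope G l e).
Proof.
move=> y0 seg xe.
pose g z := marginal G rho (x + (z - y) *: e) e + residual_slope G l e.
have xy : x + (y - y) *: e = x by rewrite subrr scale0r addr0.
have x0 : flow_nonneg G x by rewrite -xy; exact: seg.
have -> : marginal G rho x e + residual_slope G l e = g y by rewrite /g xy.
have tau0 : z - y @[z --> within nonneg (nbhs y)] --> (0 : R).
  by rewrite -(subrr y); apply: cvgB; [exact: cvg_within|exact: cvg_cst].
have segn : \forall z \near within nonneg (nbhs y), flow_nonneg G (x + (z - y) *: e).
  exact: near_nonneg.
(* The inequality based at the moved flow needs its relocation flows positive or unmoved; positivity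
   at [x] persists near [y], uniformly over the finitely many pairs. *)
have posn : \forall z \near within nonneg (nbhs y), forall p : node * node,
    p.1 \in drivers G -> p.2 \in riders G ->
    0 < reloc (x + (z - y) *: e) p \/ reloc e p = 0.
  apply: filter_forall => -[r s]; have [rD|rD] := boolP (r \in drivers G); last first.
    by apply: filterE => z.
  have [sR|sR] := boolP (s \in riders G); last first.
    by apply: filterE => z _.
  have [q0|->] := xe r s rD sR; last by apply: filterE => z _ _; right.
  have h : reloc (x + (z - y) *: e) (r, s) @[z --> within nonneg (nbhs y)]
      --> reloc x (r, s) by exact: cvg_line (reloc_scalar (r, s)) tau0.
  by move: h => /cvgr_gt /(_ _ q0); apply: filterS => z ? _ _; left.
apply: derivative_of_subgradient => //; last first.
  apply: cvgD; last exact: cvg_cst.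
  rewrite xy; have -> : marginal G rho = marginal G (fun s => - - rho s).
    by congr marginal; apply/funext => s; rewrite opprK.
  apply: (marginal_cvg (dpsi := fun s _ => - rho s) time_continuous) => //.
  by move=> s _; apply: continuous_subspaceT => v; exact: cvg_cst.
apply: filterS2 segn posn => z z0 zpos.
rewrite !lagrangianE residual_term_line /g xy.
set xz := x + (z - y) *: e.
have marg z' c : marginal G rho z' (c *: e) = c * marginal G rho z' e.
  exact: (scalar_scale _ _ (@marginal_scalar _ _ _ _ _ _)).
have relE p : reloc xz p = reloc x p + (z - y) * reloc e p by [].
have h1 : (z - y) * marginal G rho x e <= linear_potential rho xz - linear_potential rho x.
  rewrite -marg (_ : (z - y) *: e = xz - x); last by rewrite /xz addrAC subrr add0r.
  apply: linear_potential_subgradient => // r s rD sR.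
  by have [|e0] := xe r s rD sR; [left|right; rewrite relE e0 mulr0 addr0].
have h2 : (y - z) * marginal G rho xz e <= linear_potential rho x - linear_potential rho xz.
  rewrite -marg (_ : (y - z) *: e = x - xz); last first.
    by rewrite /xz opprD addNKr -scaleNr opprB.
  apply: linear_potential_subgradient => // r s rD sR.
  by have [|e0] := zpos (r, s) rD sR; [left|right; rewrite relE e0 mulr0 addr0].
by split; lra.
Qed.

Lemma set_vhatE x p (z : R) :
  Flow [eta vhat x with p |-> z] (vcheck x) (reloc x)
  = x + (z - vhat x p) *: vhat_unit p.
Proof.
apply: flowP => p' /=; rewrite ?mulr0 ?addr0//.
by case: eqP => [->|_]; rewrite (mulr1, mulr0) ?addr0// addrC subrK.
Qed.

Lemma set_vcheckE x p (z : R) :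
  Flow (vhat x) [eta vcheck x with p |-> z] (reloc x)
  = x + (z - vcheck x p) *: vcheck_unit p.
Proof.
apply: flowP => p' /=; rewrite ?mulr0 ?addr0//.
by case: eqP => [->|_]; rewrite (mulr1, mulr0) ?addr0// addrC subrK.
Qed.

Lemma set_relocE x p (z : R) :
  Flow (vhat x) (vcheck x) [eta reloc x with p |-> z]
  = x + (z - reloc x p) *: reloc_unit p.
Proof.
apply: flowP => p' /=; rewrite ?mulr0 ?addr0//.
by case: eqP => [->|_]; rewrite (mulr1, mulr0) ?addr0// addrC subrK.
Qed.

Lemma vhat_derivative l rho x d r s a : flow_nonneg G x ->
  r \in drivers G -> s \in riders G ->
  derivative_on_nonneg (fun z => SL_lagrangian G l rho
     (Flow [eta vhat x with (r, s, a) |-> z] (vcheck x) (reloc x)) d)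
    (vhat x (r, s, a)) (vhat_coef G l x r s a).
Proof.
move=> x0 rD sR; have [x1 x2 x3] := x0.
under eq_fun do rewrite set_vhatE.
rewrite -(vhat_slope _ rho) //; apply: lagrangian_derivative; first exact: x1.
  move=> z z0; rewrite -set_vhatE; split=> //= i j iP jP b.
  by case: ifP => // _; exact: x1.
by move=> *; right.
Qed.

Lemma vcheck_derivative l rho x d s k a : flow_nonneg G x ->
  s \in riders G -> k \in dests G ->
  derivative_on_nonneg (fun z => SL_lagrangian G l rho
     (Flow (vhat x) [eta vcheck x with (s, k, a) |-> z] (reloc x)) d)
    (vcheck x (s, k, a)) (vcheck_coef G l x s k a).
Proof.
move=> x0 sR kK; have [x1 x2 x3] := x0.
under eq_fun do rewrite set_vcheckE.
rewrite -(vcheck_slope _ rho) //; apply: lagrangian_derivative; first exact: x2.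
  move=> z z0; rewrite -set_vcheckE; split=> //= i j iP jP b.
  by case: ifP => // _; exact: x2.
by move=> *; right.
Qed.

Lemma reloc_derivative l rho x d r s : flow_nonneg G x ->
  r \in drivers G -> s \in riders G -> 0 < reloc x (r, s) ->
  derivative_on_nonneg (fun z => SL_lagrangian G l rho
     (Flow (vhat x) (vcheck x) [eta reloc x with (r, s) |-> z]) d)
    (reloc x (r, s)) (reloc_coef G l rho x r s).
Proof.
move=> x0 rD sR q0; have [x1 x2 x3] := x0.
under eq_fun do rewrite set_relocE.
rewrite -reloc_slope //; apply: lagrangian_derivative; first exact: x3.
  move=> z z0; rewrite -set_relocE; split=> //= i j iP jP.
  by case: ifP => // _; exact: x3.
move=> r' s' _ _ /=; case: eqP => [->|_]; [by left|by right].
Qed.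

Lemma price_derivative l rho x d s : s \in riders G -> 0 <= d s ->
  derivative_on_nonneg (fun z => SL_lagrangian G l rho x [eta d with s |-> z])
    (d s) (dquad G s (d s) + rho s).
Proof.
move=> sR d0; pose g z := dquad G s z + rho s.
have gc : g z @[z --> within nonneg (nbhs (d s))] --> g (d s).
  apply: cvgD; last exact: cvg_cst.
  apply: cvgM; first exact: cvg_cst.
  by apply: cvgB; [exact: cvg_within|exact: cvg_cst].
apply: (@derivative_of_subgradient _ _ g) => //.
apply: near_nonneg => z z0.
have diff z1 z2 : SL_lagrangian G l rho x [eta d with s |-> z1]
    - SL_lagrangian G l rho x [eta d with s |-> z2]
    = quad G s z1 - quad G s z2 + rho s * (z1 - z2).
  rewrite !lagrangianE (bigD1 s)//= [in X in _ - X](bigD1 s)//= eqxx.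
  set S1 := \sum_(i in _ | _) _; set S2 := \sum_(i in _ | _) _.
  have -> : S1 = S2.
    by apply: eq_bigr => i /andP[_ /negPf ->].
  ring.
rewrite !diff /g.
have := quad_subgradient slope_gt0 sR d0 z0.
have := quad_subgradient slope_gt0 sR z0 d0.
by split; lra.
Qed.

(* At [0] the difference quotients of [z * ln z] tend to [-oo]. *)
Lemma reloc_stationary_gt0 l rho x d r s : flow_nonneg G x ->
  r \in drivers G -> s \in riders G ->
  stationary (fun z => SL_lagrangian G l rho
     (Flow (vhat x) (vcheck x) [eta reloc x with (r, s) |-> z]) d)
    (reloc x (r, s)) ->
  0 < reloc x (r, s).
Proof.
move=> x0 rD sR; have [x1 x2 x3] := x0.
move=> [nu [nuE _ _]]; rewrite lt_neqAle x3// andbT; apply/eqP => q0.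
pose xz (z : R) := x + z *: reloc_unit (r, s).
have xzE z : xz z = Flow (vhat x) (vcheck x) [eta reloc x with (r, s) |-> z].
  by rewrite set_relocE -q0 subr0.
have xz0 : xz 0 = x by rewrite /xz scale0r addr0.
have xzq z : reloc (xz z) (r, s) = z by rewrite xzE /= eqxx.
(* The subgradient inequality is based at the moved flow, whose coordinate [z] is positive, and
   directed back to [x]; it bounds the difference quotient above by a coefficient containing
   [ln z]. *)
have slope_le (z : R) : 0 < z ->
    SL_lagrangian G l rho (xz z) d - SL_lagrangian G l rho x d
    <= z * reloc_coef G l rho (xz z) r s.
  move=> z0; rewrite !lagrangianE residual_term_line -reloc_slope//.
  have xzn : flow_nonneg G (xz z).
    rewrite xzE; split=> //= i j iP jP; case: ifP => _; [exact: ltW|exact: x3].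
  have : marginal G rho (xz z) (x - xz z)
      <= linear_potential rho x - linear_potential rho (xz z).
    apply: linear_potential_subgradient => // i j iD jR.
    have [[-> ->]|ne] := eqVneq (i, j) (r, s); first by left; rewrite xzq.
    by right; rewrite xzE /= (negPf ne).
  rewrite (_ : x - xz z = - z *: reloc_unit (r, s)); last first.
    by rewrite /xz opprD addNKr scaleNr.
  rewrite (scalar_scale _ _ (@marginal_scalar _ _ _ _ _ _)) => h.
  by lra.
(* Only the logarithm depends on the flow, and in the coefficient at [x] it is [ln 0], which is 0 by
   convention. *)
have coefE z : reloc_coef G l rho (xz z) r s
    = (beta2 G)^-1 * ln z + reloc_coef G l rho x r s.
  by rewrite /reloc_coef xzq -q0 (ln0 (lexx 0)); ring.
set C := reloc_coef G l rho x r s in coefE.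
have nu_le : \forall z \near (0 : R)^'+, nu - 1 <= (beta2 G)^-1 * ln z + C.
  move: nuE; rewrite /derivative_on_nonneg -q0 => /cvgr_ge/(_ (nu - 1)).
  rewrite ltrBlDr ltrDl ltr01 => /(_ isT) /(at_right_nonneg (lexx 0)) nu_le.
  near=> z; have z0 : 0 < z by near: z; exact: nbhs_right_gt.
  rewrite -coefE; apply: (@le_trans _ _ ((SL_lagrangian G l rho (xz z) d
    - SL_lagrangian G l rho x d) / z)); last first.
    by rewrite ler_pdivrMr// mulrC slope_le.
  have -> : SL_lagrangian G l rho x d = SL_lagrangian G l rho (xz 0) d by rewrite xz0.
  by rewrite !xzE -[X in _ / X]subr0; near: z.
(* The lower bound [nu - 1] on the quotients would force [ln z >= u + 1], which fails as soon as
   [z < expR u]. *)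
pose u := beta2 G * (nu - 1 - C) - 1.
have [z [nz zu z0]] : exists z, [/\ nu - 1 <= (beta2 G)^-1 * ln z + C,
    z < expR u & 0 < z].
  near (0 : R)^'+ => z; exists z; split; near: z => //.
    by apply: nbhs_right_lt; exact: expR_gt0.
  exact: nbhs_right_gt.
have : ln z < u by rewrite -ltr_expR lnK.
have : beta2 G * (nu - 1) <= ln z + beta2 G * C.
  have -> : ln z + beta2 G * C = beta2 G * ((beta2 G)^-1 * ln z + C).
    by rewrite [RHS]mulrDr mulVKf// gt_eqF.
  by rewrite ler_pM2l.
by rewrite /u; lra.
Unshelve. all: end_near. Qed.

End KKT.

(** * Equivalence of the KKT conditions and the variational inequality *)

Section KKTVariational.
Context {R : realType} {node link : finType}.
Variable G : network R node link.
Local Notation flow := (flow R node link).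
Implicit Types (x y e : flow) (rho d : node -> R).

Hypothesis time_continuous :
  forall a, {within `[0, +oo[, continuous (travel_time G a)}.
Hypothesis time_increasing :
  forall a u v, 0 <= u -> u < v -> travel_time G a u < travel_time G a v.
Hypothesis beta1_gt0 : 0 < beta1 G.
Hypothesis beta2_gt0 : 0 < beta2 G.
Hypothesis slope_gt0 : {in riders G, forall s, 0 < slope G s}.

Lemma stationary_derivative (phi : R -> R) (y g : R) : 0 <= y ->
  derivative_on_nonneg phi y g -> stationary phi y -> 0 <= g /\ g * y = 0.
Proof.
by move=> y0 phig [nu [/(derivative_on_nonneg_uniq y0 phig) <-]].
Qed.

(** Between feasible flows the residuals do not change, so [marginal] equals the sum of the reduced
    costs times the coordinates of [y - x]. Complementary slackness removes the part of [x], and the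
    sign conditions make that of [y] nonnegative. *)
Lemma KKT_variational l rho x d : flow_feasible G x -> SL_KKT G l rho x d ->
  reloc_pos G x /\ variational G rho x.
Proof.
move=> xF [k1 k2 k3 _]; have [xn _ _ _] := xF; have [x1 x2 x3] := xn.
have xpos : reloc_pos G x.
  by move=> r s rD sR; apply: reloc_stationary_gt0 (k3 r s rD sR).
split=> // y yF; have [[y1 y2 y3] _ _ _] := yF.
have := slopeE G l rho x (y - x); rewrite residual_slope0// addr0 => ->.
have step (c u v : R) : 0 <= c /\ c * u = 0 -> 0 <= v -> 0 <= c * (v - u).
  by move=> [c0 cu] v0; rewrite mulrBr cu subr0 mulr_ge0.
rewrite !addr_ge0//.
- apply: sumr_ge0 => r rD; apply: sumr_ge0 => s sR; apply: sumr_ge0 => a _.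
  apply: step; last exact: y1.
  apply: stationary_derivative (k1 r s rD sR a); first exact: x1.
  exact: vhat_derivative.
- apply: sumr_ge0 => s sR; apply: sumr_ge0 => k kK; apply: sumr_ge0 => a _.
  apply: step; last exact: y2.
  apply: stationary_derivative (k2 s k sR kK a); first exact: x2.
  exact: vcheck_derivative.
- apply: sumr_ge0 => r rD; apply: sumr_ge0 => s sR.
  apply: step; last exact: y3.
  apply: stationary_derivative (k3 r s rD sR); first exact: x3.
  by apply: reloc_derivative => //; exact: xpos.
Qed.

Lemma near_ray (u w : R) : 0 <= u -> (u = 0 -> 0 <= w) ->
  \forall t \near (0 : R)^'+, 0 <= u + t * w.
Proof.
rewrite le_eqVlt => /predU1P[<-|u0 _].
  move=> /(_ erefl) w0; near=> t; rewrite add0r.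
  have t0 : 0 < t by near: t; exact: nbhs_right_gt.
  by rewrite mulr_ge0// ltW.
have : u + t * w @[t --> (0 : R)^'+] --> u.
  have tau0 : t @[t --> (0 : R)^'+] --> (0 : R).
    by apply: cvg_at_right_filter; exact: cvg_id.
  have := cvgD (cvg_cst u) (cvgM tau0 (cvg_cst w)).
  by rewrite mul0r addr0; apply.
by move=> /cvgr_ge; apply.
Unshelve. all: end_near. Qed.

Local Notation coordinate := (node * node * link + node * node * link)%type.
Local Notation constraint :=
  (node * node * node + node * node * node + node)%type.

(* A direction along which the zero link flows do not decrease and the linear
   constraints are preserved is feasible for a small step, as all relocation
   flows are positive; this is the hypothesis of Farkas' lemma. *)
Lemma variational_multipliers rho x : flow_feasible G x -> reloc_pos G x ->
  variational G rho x -> exists l,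
  [/\ {in drivers G & riders G, forall r s a,
         0 <= vhat_coef G l x r s a /\ vhat_coef G l x r s a * vhat x (r, s, a) = 0},
      {in riders G & dests G, forall s k a,
         0 <= vcheck_coef G l x s k a /\ vcheck_coef G l x s k a * vcheck x (s, k, a) = 0} &
      {in drivers G & riders G, forall r s, reloc_coef G l rho x r s = 0}].
Proof.
move=> xF xpos xV; have [[x1 x2 x3] x4 x5 x6] := xF.
pose A (j : coordinate) e := match j with
  | inl p => vhat e p | inr p => vcheck e p end.
pose P (j : coordinate) := match j with
  | inl p => [&& p.1.1 \in drivers G, p.1.2 \in riders G & vhat x p == 0]
  | inr p => [&& p.1.1 \in riders G, p.1.2 \in dests G & vcheck x p == 0] end.
pose E (k : constraint) e := match k with
  | inl (inl p) => vhat_residual G e p.1.1 p.1.2 p.2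
  | inl (inr p) => - vcheck_net G e p.1.1 p.1.2 p.2
  | inr r => - sent G e r end.
pose Q (k : constraint) := match k with
  | inl (inl p) => (p.1.1 \in drivers G) && (p.1.2 \in riders G)
  | inl (inr p) => (p.1.1 \in riders G) && (p.1.2 \in dests G)
  | inr r => r \in drivers G end.
have oppS (f : flow -> R) : scalar f -> scalar (fun e => - f e).
  by move=> lf c u v; rewrite lf opprD mulrN.
have [| | |e eA eE|L [M [L0 LM]]] := @farkas_eq _ _ coordinate constraint P Q A E
    (marginal G rho x).
- by case.
- move=> [[p|p]|r].
  + exact: vhat_residual_scalar.
  + exact/oppS/vcheck_net_scalar.
  + exact/oppS/sent_scalar.
- exact: marginal_scalar.
- have near_vhat : \forall t \near (0 : R)^'+, forall p,
      p.1.1 \in drivers G -> p.1.2 \in riders G -> 0 <= vhat (x + t *: e) p.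
    apply: filter_forall => -[[r s] a] /=.
    have [rD|rD] := boolP (r \in drivers G); last by apply: filterE => t.
    have [sR|sR] := boolP (s \in riders G); last by apply: filterE => t _.
    apply: filterS (near_ray (x1 r s rD sR a) (_ : _ -> 0 <= vhat e (r, s, a))) => //.
    by move=> x0; apply: (eA (inl (r, s, a))); rewrite /= rD sR x0 eqxx.
  have near_vcheck : \forall t \near (0 : R)^'+, forall p,
      p.1.1 \in riders G -> p.1.2 \in dests G -> 0 <= vcheck (x + t *: e) p.
    apply: filter_forall => -[[s k] a] /=.
    have [sR|sR] := boolP (s \in riders G); last by apply: filterE => t.
    have [kK|kK] := boolP (k \in dests G); last by apply: filterE => t _.
    apply: filterS (near_ray (x2 s k sR kK a) (_ : _ -> 0 <= vcheck e (s, k, a))) => //.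
    by move=> x0; apply: (eA (inr (s, k, a))); rewrite /= sR kK x0 eqxx.
  have near_reloc : \forall t \near (0 : R)^'+, forall p,
      p.1 \in drivers G -> p.2 \in riders G -> 0 <= reloc (x + t *: e) p.
    apply: filter_forall => -[r s] /=.
    have [rD|rD] := boolP (r \in drivers G); last by apply: filterE => t.
    have [sR|sR] := boolP (s \in riders G); last by apply: filterE => t _.
    apply: filterS (near_ray (x3 r s rD sR) (_ : _ -> 0 <= reloc e (r, s))) => //.
    by move=> x0; have := xpos r s rD sR; rewrite x0 ltxx.
  near (0 : R)^'+ => t.
  have t0 : 0 < t by near: t; exact: nbhs_right_gt.
  have yF : flow_feasible G (x + t *: e).
    split; first split.
    - move=> r s rD sR a; suff : forall p, p.1.1 \in drivers G ->
          p.1.2 \in riders G -> 0 <= vhat (x + t *: e) p by apply.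
      by near: t.
    - move=> s k sR kK a; suff : forall p, p.1.1 \in riders G ->
          p.1.2 \in dests G -> 0 <= vcheck (x + t *: e) p by apply.
      by near: t.
    - move=> r s rD sR; suff : forall p, p.1 \in drivers G ->
          p.2 \in riders G -> 0 <= reloc (x + t *: e) p by apply.
      by near: t.
    - move=> r s rD sR i; rewrite (scalar_line _ _ _ (@vhat_residual_scalar _ _ _ G r s i)).
      have -> : vhat_residual G e r s i = 0.
        by apply: (eE (inl (inl (r, s, i)))); rewrite /= rD.
      by rewrite x4// mulr0 addr0.
    - move=> s k sR kK i; rewrite vcheck_residualE.
      rewrite (scalar_line _ _ _ (@vcheck_net_scalar _ _ _ G s k i)) opprD addrA.
      have -> : vcheck_net G e s k i = 0.
        by apply/oppr_inj; rewrite oppr0; apply: (eE (inl (inr (s, k, i)))); rewrite /= sR.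
      by rewrite -vcheck_residualE x5// mulr0 subr0.
    - move=> r rD; rewrite supply_residualE.
      rewrite (scalar_line _ _ _ (@sent_scalar _ _ _ G r)) opprD addrA.
      have -> : sent G e r = 0.
        by apply/oppr_inj; rewrite oppr0; apply: (eE (inr r)).
      by rewrite -supply_residualE x6// mulr0 subr0.
  have := xV _ yF; rewrite addrAC subrr add0r.
  by rewrite (scalar_scale _ _ (@marginal_scalar _ _ _ _ _ _)) pmulr_rge0.
(* The functionals [E] carry the signs of [residual_slope]. Farkas' lemma puts [M] on the side
   opposite to [marginal], while the Lagrangian adds the residual terms to it, hence the
   negation. *)
pose l := @Multipliers R node (fun r s i => - M (inl (inl (r, s, i))))
  (fun s k i => - M (inl (inr (s, k, i)))) (fun r => - M (inr r)).
have lE e : marginal G rho x e + residual_slope G l e = \sum_(j | P j) L j * A j e.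
  rewrite LM -[RHS]addr0 -addrA; congr (_ + _).
  rewrite -[RHS](subrr (\sum_(k | Q k) M k * E k e)); congr (_ + _).
  rewrite /residual_slope !sum3_pair -sumrN !big_sumType /=.
  congr (_ + _ + _); apply: eq_bigr => k _; rewrite mulNr //;
    by case: k => -[].
exists l; split.
(* A unit direction isolates the Farkas multiplier of its own coordinate. This coordinate is among
   the inequalities only if it vanishes in [x], which is complementary slackness; relocation
   coordinates carry no inequality, so their coefficient is 0. *)
- move=> r s rD sR a; rewrite -(vhat_slope l rho x a rD sR) lE; split.
    by apply: sumr_ge0 => -[p|p] _; apply: mulr_ge0 => //=; exact: ler0n.
  have [->|x0] := eqVneq (vhat x (r, s, a)) 0; first by rewrite mulr0.
  rewrite big1 ?mul0r// => -[p|p] /=; last by rewrite mulr0.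
  by case: (p =P _) => [->|]; rewrite ?mulr0// (negPf x0) !andbF.
- move=> s k sR kK a; rewrite -(vcheck_slope l rho x a sR kK) lE; split.
    by apply: sumr_ge0 => -[p|p] _; apply: mulr_ge0 => //=; exact: ler0n.
  have [->|x0] := eqVneq (vcheck x (s, k, a)) 0; first by rewrite mulr0.
  rewrite big1 ?mul0r// => -[p|p] /=; first by rewrite mulr0.
  by case: (p =P _) => [->|]; rewrite ?mulr0// (negPf x0) !andbF.
- move=> r s rD sR; rewrite -(reloc_slope l rho x rD sR) lE.
  by rewrite big1// => -[p|p] _ /=; rewrite mulr0.
Unshelve. all: end_near. Qed.

Lemma variational_KKT rho x d : flow_feasible G x -> reloc_pos G x ->
  variational G rho x ->
  {in riders G, forall s, 0 <= d s} ->
  {in riders G, forall s, dquad G s (d s) + rho s = 0} ->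
  exists l, SL_KKT G l rho x d.
Proof.
move=> xF xpos xV d0 dE; have [xn _ _ _] := xF.
have [l [l1 l2 l3]] := variational_multipliers xF xpos xV.
exists l; split.
- move=> r s rD sR a; have [? ?] := l1 r s rD sR a.
  by exists (vhat_coef G l x r s a); split=> //; exact: vhat_derivative.
- move=> s k sR kK a; have [? ?] := l2 s k sR kK a.
  by exists (vcheck_coef G l x s k a); split=> //; exact: vcheck_derivative.
- move=> r s rD sR; exists 0; rewrite lexx mul0r; split=> //.
  by rewrite -(l3 r s rD sR); apply: reloc_derivative => //; exact: xpos.
- move=> s sR; exists 0; rewrite lexx mul0r; split=> //.
  by rewrite -(dE s sR); apply: price_derivative => //; exact: d0.
Qed.

End KKTVariational.

(** * The bilevel problem *)

Section Bilevel.
Context {R : realType} {node link : finType}.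
Variable G : network R node link.
Implicit Types (x : flow R node link) (rho : node -> R).

Hypothesis drivers_neq0 : drivers G != finset.set0.
Hypothesis supply_gt0 : {in drivers G, forall r, 0 < driver_supply G r}.
Hypothesis beta1_gt0 : 0 < beta1 G.
Hypothesis beta2_gt0 : 0 < beta2 G.
Hypothesis slope_gt0 : {in riders G, forall s, 0 < slope G s}.

Lemma LL_optimalP rho x :
  LL_optimal G rho x <-> minimizer G (fun s v => - rho s * v) x.
Proof.
by split=> -[xF xmin]; split=> // y yF; move: (xmin y yF);
  rewrite !potential_linearE ?gt_eqF// ler_pM2l ?divr_gt0.
Qed.

Lemma minimizer_SL_optimal x :
  minimizer G (quad G) x -> SL_optimal G x (arrivals G x).
Proof.
move=> [xF xmin]; have xd s : demand_residual G x (arrivals G x) s = 0.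
  exact: subrr.
split; first by split=> // s sR; apply: arrivals_ge0 => //; case: xF.
move=> y d [yF _ yd]; rewrite !SL_objectiveE//; exact: xmin.
Qed.

(** Without rider nodes the supply constraint at a driver node would make its positive supply equal
    to 0. *)
Lemma feasible_riders x : flow_feasible G x -> riders G != finset.set0.
Proof.
move=> [_ _ _ xS]; have /set0Pn[r rD] := drivers_neq0.
apply: contraTneq (supply_gt0 rD) => R0; have := xS r rD.
by rewrite /supply_residual R0 big_set0 subr0 => ->; rewrite ltxx.
Qed.

(** Stationarity of the Lagrangian in [d s] with zero multiplier is exactly market clearing: the
    arrivals meet the linear demand at price [rho]. *)
Lemma dquad_eq0 s v rho : s \in riders G ->
  (dquad G s v + rho s == 0) = (v == demand0 G s - slope G s * rho s).
Proof.
move=> sR; have b0 : slope G s != 0 by rewrite gt_eqF// slope_gt0.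
have -> : dquad G s v + rho s
    = (slope G s)^-1 * (v - (demand0 G s - slope G s * rho s)).
  by rewrite /dquad; field.
by rewrite mulf_eq0 invr_eq0 (negPf b0) subr_eq0.
Qed.

Lemma arrivals_gt0 x s : s \in riders G -> reloc_pos G x -> 0 < arrivals G x s.
Proof.
move=> sR xpos; have /set0Pn[r rD] := drivers_neq0.
rewrite /arrivals (bigD1 r)//= ltr_wpDr ?xpos// sumr_ge0// => i /andP[iD _].
by rewrite ltW// xpos.
Qed.

End Bilevel.

Theorem theorem1 (R : realType) (node link : finType)
  (G : network R node link)
  (drivers_neq0 : drivers G != finset.set0)
  (rider_reachable :
    {in drivers G & riders G, forall r s, reachable G r s})
  (dest_reachable :
    {in riders G & dests G, forall s k, reachable G s k})
  (time_ge0 : forall a u, 0 <= u -> 0 <= travel_time G a u)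
  (time_continuous :
    forall a, {within `[0, +oo[, continuous (travel_time G a)})
  (time_increasing :
    forall a u v, 0 <= u -> u < v -> travel_time G a u < travel_time G a v)
  (supply_gt0 : {in drivers G, forall r, 0 < driver_supply G r})
  (departures_ge0 : {in riders G, forall s, 0 <= departures G s})
  (fraction_ge0 : {in riders G & dests G, forall s k, 0 <= fraction G s k})
  (beta1_gt0 : 0 < beta1 G)
  (beta2_gt0 : 0 < beta2 G)
  (slope_gt0 : {in riders G, forall s, 0 < slope G s})
  (rho : node -> R) :
  solves_bilevel G rho <-> SL_optimal_dual G rho.
Proof.
have lsub := @linear_subgradient R node link G.
have lcont (c : node -> R) : {in riders G, forall s,
    {within [set z : R | 0 <= z], continuous (fun=> - c s)}}.
  by move=> s _; apply: continuous_subspaceT => v; exact: cvg_cst.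
have qsub := quad_subgradient slope_gt0.
have qcont : {in riders G, forall s,
    {within [set z : R | 0 <= z], continuous (dquad G s)}}.
  by move=> s _; exact: dquad_continuous.
have linear_min c x : flow_feasible G x -> reloc_pos G x ->
    variational G c x -> minimizer G (fun s v => - c s * v) x.
  move=> xF xpos xV; apply: (variational_minimizer time_continuous
    time_increasing beta1_gt0 beta2_gt0 (lsub c)) => // y yF.
  by rewrite (eq_marginal (rho' := c)) ?xV// => s _; rewrite opprK.
split=> [[m [x /(LL_optimalP beta1_gt0 beta2_gt0) xmin mE] mmin]
        |[x [d [[[xF d0 xd] _] [l kkt]]]]].
  have [xF _] := xmin.
  have R0 := feasible_riders drivers_neq0 supply_gt0 xF.
  have [y0 y0F y0pos] := exists_positive_flow R0 rider_reachable dest_reachable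
    supply_gt0 departures_ge0 fraction_ge0.
  have [z zmin] := exists_minimizer time_ge0 time_continuous time_increasing
    supply_gt0 beta1_gt0 beta2_gt0 slope_gt0 y0F.
  have zpos := minimizer_reloc_pos time_continuous time_increasing
    beta1_gt0 beta2_gt0 qsub zmin y0F y0pos.
  have zV := minimizer_variational time_continuous time_increasing
    beta1_gt0 beta2_gt0 qsub qcont zmin zpos.
  pose c s := - dquad G s (arrivals G z s).
  have cmin : minimizer G (fun s v => - c s * v) z by apply: linear_min => //; case: zmin.
  have zc s : s \in riders G -> arrivals G z s = demand0 G s - slope G s * c s.
    by move=> sR; apply/eqP; rewrite -dquad_eq0// subrr.
  have m0 : {in riders G, forall s, m s = 0}.
    have mge0 s : s \in riders G -> 0 <= m s by move=> sR; rewrite mE.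
    have msum : \sum_(s in riders G) m s <= 0.
      apply: le_trans (mmin c (fun=> 0) _) _; last by rewrite big1.
      exists z; first exact/LL_optimalP.
      by move=> s sR; rewrite -/(arrivals G z s) zc// subrr normr0.
    move=> s sR; apply/eqP; rewrite eq_le mge0// andbT (le_trans _ msum)//.
    by apply: (ler_sum_elem (f := m)).
  have xrho s : s \in riders G -> dquad G s (arrivals G x s) + rho s = 0.
    move=> sR; apply/eqP; rewrite dquad_eq0// -subr_eq0 -normr_eq0.
    by rewrite -mE// m0.
  have xpos := minimizer_reloc_pos time_continuous time_increasing
    beta1_gt0 beta2_gt0 (lsub rho) xmin y0F y0pos.
  have xV : variational G rho x.
    move=> y yF; rewrite (eq_marginal (rho' := fun s => - - rho s)).
      exact: (minimizer_variational time_continuous time_increasing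
        beta1_gt0 beta2_gt0 (lsub rho) (lcont rho) xmin xpos).
    by move=> s _; rewrite opprK.
  exists x, (arrivals G x); split; last first.
    apply: variational_KKT => // s sR; apply: arrivals_ge0 => //.
    by case: xF.
  (* By [xrho], the quadratic term assigns the price [rho s] to the arrivals of [x] at each rider
     node [s], so the inequality [xV] is also the one required for the potential with [quad]. *)
  apply: minimizer_SL_optimal; apply: (variational_minimizer time_continuous
    time_increasing beta1_gt0 beta2_gt0 qsub) => // y yF.
  rewrite (eq_marginal (rho' := rho)) ?xV// => s sR.
  by apply/eqP; rewrite eqr_oppLR -addr_eq0 xrho.
have [xpos xV] := KKT_variational time_continuous time_increasing beta1_gt0
  beta2_gt0 xF kkt.
have xrho s : s \in riders G -> arrivals G x s = demand0 G s - slope G s * rho s.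
  move=> sR; have /subr0_eq dE : d s - arrivals G x s = 0 by exact: xd.
  have [_ _ _ /(_ s sR) st] := kkt.
  (* Here [d s] equals the arrivals, which are positive because all relocation flows are and there
     is a driver node; complementary slackness then turns the inequality into market clearing. *)
  have [_] : 0 <= dquad G s (d s) + rho s /\ (dquad G s (d s) + rho s) * d s = 0.
    by apply: stationary_derivative st; [exact: d0|apply: price_derivative => //; exact: d0].
  move=> /eqP; rewrite dE mulf_eq0 [X in _ || X]gt_eqF ?arrivals_gt0// orbF.
  by rewrite dquad_eq0// => /eqP.
exists (fun=> 0).
  exists x; first by apply/LL_optimalP => //; exact: linear_min.
  by move=> s sR; rewrite -/(arrivals G x s) xrho// subrr normr0.
move=> rho' m' [x' _ mE]; rewrite big1// sumr_ge0// => s sR.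
by rewrite mE.
Qed.
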